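(* Let $\alpha>0$, $\tau,C>0$ and $\beta_0>\beta_1>0$ (and it may be that $\beta_0=\infty$) be given; $\tau$, $C$ and $C'>0$ are known. For a sequence $(\rho_n)_n$ consider, from $n$ i.i.d. observations with distribution function $F$, the testing problem $$H_0:\ F\in\mathcal S(\tau,\beta_0,C,C')\quad\text{vs.}\quad H_1:\ F\in\tilde{\mathcal S}(\tau,\beta_1,\beta_0,C,C',\rho_n).$$ Then: A. An $\alpha$-uniformly consistent test between $H_0$ and $H_1$ exists for some sequence $(\rho_n)_n$ such that $$\limsup_{n\to\infty}\rho_n\,n^{\beta_1/(2\beta_1+1)}<\infty .$$ B. If there exists an $\alpha$-uniformly consistent test between $H_0$ and $H_1$, then necessarily $$\liminf_{n\to\infty}\rho_n\,n^{\beta_1/(2\beta_1+1)}>0.$$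
   Context: $\mathcal D$ denotes the set of càdlàg distribution functions of probability distributions on $\mathbb R^+$. For $\tau,\beta,C,C'>0$, $$\mathcal S(\tau,\beta,C,C')=\{F\in\mathcal D:\ \forall x \text{ with } F(x)\in(0,1],\ |1-F(x)-Cx^{-\tau}|\le C'x^{-\tau(\beta+1)}\}.$$ For $\beta=\infty$, $\mathcal S(\tau,\infty,C,C')$ contains only the distribution $F_0(x)=1-Cx^{-\tau}$ for $x\ge C^{1/\tau}$. Distance: $\|F-F_0\|_{\infty,\tau}=\sup_{x:\,F(x)\in(0,1)}|x^\tau(1-F(x))-x^\tau(1-F_0(x))|$, and $\|F-\mathcal A\|_{\infty,\tau}=\inf_{F_0\in\mathcal A}\|F-F_0\|_{\infty,\tau}$ for a set $\mathcal A$ of distributions. For $\rho\ge0$, $$\tilde{\mathcal S}(\tau,\beta_1,\beta_0,C,C',\rho)=\{F\in\mathcal S(\tau,\beta_1,C,C'):\ \|F-\mathcal S(\tau,\beta_0,C,C')\|_{\infty,\tau}\ge\rho\}.$$ A test $\Psi_n$ is a $\{0,1\}$-valued measurable function of $n$ i.i.d. observations $X_1,\dots,X_n$ from $F$. It is $\alpha$-uniformly consistent between $H_0$ and $H_1$ if for $n$ large enough $$\sup_{F\in H_0}\mathbb E_F\Psi_n+\sup_{F\in H_1}\mathbb E_F(1-\Psi_n)\le\alpha .$$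
   Formalization: Part B is stated for α<1 only: for α≥1 it is false, since the test Ψ_n=0 has total error at most 1≤α for every sequence, e.g. ρ_n=0, whose rescaled liminf is 0. Part A is stated for every α>0. *)

(* Defs.v *)
From HB Require Import structures.
From mathcomp Require Import all_boot all_order all_algebra.
From mathcomp Require Export all_classical all_reals all_analysis.

Set Implicit Arguments.
Unset Strict Implicit.
Unset Printing Implicit Defensive.

Import Order.TTheory GRing.Theory Num.Theory.
Import numFieldNormedType.Exports.

Local Open Scope classical_set_scope.
Local Open Scope ring_scope.

Section iid.
Context d (T : measurableType d) (R : realType).

Definition cons_pair n (z : T * n.-tuple T) : n.+1.-tuple T :=
  [tuple of z.1 :: z.2].

Lemma measurable_cons_pair n : measurable_fun [set: T * n.-tuple T] (@cons_pair n).
Proof. exact: measurable_cons. Qed.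

HB.instance Definition _ n :=
  @isMeasurableFun.Build _ _ (T * n.-tuple T)%type (n.+1.-tuple T)
    (@cons_pair n) (@measurable_cons_pair n).

(* The n-fold product measure of P, i.e. the joint law of n i.i.d. observations
   with common law P; [iid_lawE] is its characterization on rectangles. *)
Fixpoint iid_law (P : probability T R) n : probability (n.-tuple T) R :=
  match n return probability (n.-tuple T) R with
  | 0 => dirac [tuple]
  | m.+1 => distribution (P \x iid_law P m)%E (@cons_pair m)
  end.

Lemma iid_lawE (P : probability T R) n (A : 'I_n -> set T) :
  (forall i, measurable (A i)) ->
  iid_law P n [set t | forall i, A i (tnth t i)] = (\prod_(i < n) P (A i))%E.
Proof.
elim: n A => [|n IHn] A mA.
  rewrite big_ord0 /= diracE (_ : _ \in _ = true)//.
  by apply/mem_set => -[].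
rewrite big_ord_recl -IHn; last by move=> i; exact: mA.
rewrite /= /distribution /pushforward.
rewrite (_ : _ @^-1` _ =
  A ord0 `*` [set t | forall i, A (lift ord0 i) (tnth t i)]); last first.
  apply/seteqP; split=> [[x t] /= Axt|[x t] /= [Ax At] i].
    split; first exact: (Axt ord0).
    by move=> i; have := Axt (lift ord0 i); rewrite tnthS.
  by case: (unliftP ord0 i) => [j ->|->//]; rewrite tnthS.
apply: product_measure1E => //.
rewrite (_ : [set t | _] = \bigcap_(i in [set: 'I_n])
    (fun t => tnth t i) @^-1` A (lift ord0 i)); last first.
  by apply/seteqP; split=> t /= H => [i _|i]; exact: H.
apply: fin_bigcap_measurable => // i _.
by rewrite -[X in measurable X]setTI; exact: measurable_tnth.
Qed.

End iid.

Section pareto.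
Context {R : realType}.
Implicit Types F G : R -> R.

Definition has_df (P : probability (measurableTypeR R) R) F := forall x : R, P `]-oo, x]%classic = (F x)%:E.

Definition nonneg_df : set (R -> R) :=
  [set F | exists2 P : probability (measurableTypeR R) R,
     P `[0, +oo[%classic = 1%E & has_df P F].

Definition exact_pareto (tau C : R) : R -> R :=
  fun x => if C `^ tau^-1 <= x then 1 - C * x `^ (- tau) else 0.

(* The condition is imposed for 0 < x only: F vanishes on the negative
   half-line, and x^{-tau} is not defined at x = 0 (the library's junk value
   0 `^ (- tau) = 0 would forbid an atom at 0). *)
Definition pareto_class (tau : R) (beta : \bar R) (C C' : R) : set (R -> R) :=
  match beta with
  | EFin b => [set F | nonneg_df F /\ forall x : R, 0 < x -> 0 < F x <= 1 ->
      `|1 - F x - C * x `^ (- tau)| <= C' * x `^ (- (tau * (b + 1)))]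
  | +oo%E => [set exact_pareto tau C]
  | -oo%E => set0
  end.

(* The supremum is over the x with F x in ]0, 1[, hence not symmetric. *)
Definition wdist (tau : R) F G : \bar R :=
  ereal_sup [set `|x `^ tau * (1 - F x) - x `^ tau * (1 - G x)|%:E
            | x in [set x : R | 0 < F x < 1]].

Definition wdist_set (tau : R) F (A : set (R -> R)) : \bar R :=
  ereal_inf [set wdist tau F G | G in A].

Definition separated_class (tau beta1 : R) (beta0 : \bar R) (C C' rho : R) :
    set (R -> R) :=
  [set F | pareto_class tau beta1%:E C C' F /\
    (rho%:E <= wdist_set tau F (pareto_class tau beta0 C C'))%E].

Definition test n := {mfun (n.-tuple (measurableTypeR R)) >-> bool}.

(* sup over F in H of E_F[f(X_1, ..., X_n)] for f >= 0, the supremum being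
   taken in [0, +oo] (so that it is 0 when H is empty). *)
Definition sup_risk n (H : set (R -> R))
    (f : n.-tuple (measurableTypeR R) -> R) : \bar R :=
  maxe 0%E (ereal_sup [set 'E_(iid_law P n)[f]%E
                      | P in [set P | exists2 F, H F & has_df P F]]).

Definition uniformly_consistent (alpha : R) (H0 H1 : nat -> set (R -> R))
    (Psi : forall n, test n) :=
  \forall n \near \oo,
    (sup_risk (H0 n) (fun X => (Psi n X)%:R)
     + sup_risk (H1 n) (fun X => 1 - (Psi n X)%:R)%R <= alpha%:E)%E.

End pareto.

(* Main.v *)
Require Import Defs.
From HB Require Import structures.
From mathcomp Require Import all_boot all_order all_algebra.
From mathcomp Require Import all_classical all_reals all_analysis.
From mathcomp Require Import measurable_realfun ring lra.

Set Implicit Arguments.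
Unset Strict Implicit.
Unset Printing Implicit Defensive.

Import Order.TTheory GRing.Theory Num.Theory.
Import numFieldNormedType.Exports.

Local Open Scope classical_set_scope.
Local Open Scope ring_scope.

(** Upper bound.  The ratio of the empirical tail to the tail 1 - F(x) is a
    martingale in x, so by Doob's L^2 inequality its largest deviation from 1 on
    (0, b] is controlled by its variance at b, of order b^tau / n.  As
    x^tau (1 - F(x)) is bounded over the classes, for b^tau of order
    n^(1 / (2 beta1 + 1)) this controls the weighted error of the empirical tail
    on (0, b] up to a fraction of rho_n; beyond b every F in S(beta1) is within
    rho_n / 2 of the Pareto tail.  One rejects when the empirical tail leaves the
    band of H0 by a multiple of rho_n on (0, b].  This is powerful because an F
    which stays within rho_n / 2 of the band has a neighbour in S(beta0).

    Lower bound.  The exact Pareto law is compared with the law whose density with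
    respect to it is 1 + delta and 1 - delta on two adjacent intervals of
    probability s = C y, where y is of order n^(-1 / (2 beta1 + 1)) and delta of
    order y^beta1.  The perturbed law is at distance at least C' y^beta1 / 4 from
    S(beta0), while the chi-square divergence of the n-fold products,
    (1 + 2 delta^2 s)^n - 1, is as small as desired. *)

(** * Maximal inequality for the tail ratio in a finite model *)

(** The weight x^tau rules out a plain uniform bound on the empirical tail: an error n^(-1/2)
    multiplied by b^tau = n^(1 / (2 beta1 + 1)) exceeds rho_n by a power of n. A relative error of
    order (b^tau / n)^(1/2), uniform on (0, b], costs no logarithm and has exactly the rate; the
    same b balances the bias b^(-tau beta1). To avoid conditional expectations, observations are
    quantised by finitely many points, where the martingale property becomes an orthogonality
    relation between finite sums; all rational points are then reached by a monotone limit. Two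
    degenerate situations shape the details: the classes impose nothing where F vanishes, so those
    points are treated almost surely, and for infinite beta0 the null hypothesis is a single law. In
    the lower bound the chi-square cost of one observation is of order y^(2 beta1 + 1), that is 1 /
    n at the chosen y, while beta0 > beta1 makes the band of S(beta0) narrower than the perturbation
    once y is small. *)

Section finite_iid.
Context {R : realFieldType} {T : finType} (p : T -> R).
Context (p_ge0 : forall v, 0 <= p v) (p_sum1 : \sum_v p v = 1).
Implicit Types (f g h : seq T -> R) (phi psi : T -> R).

(** Expectation under n independent draws from p, peeling off the head observation as [iid_law]
    does. Working on [seq T] lets a sample be split around one observation without length casts. *)
Fixpoint iid_expect n f : R :=
  if n is m.+1 then \sum_v p v * iid_expect m (fun s => f (v :: s)) else f [::].

Lemma eq_iid_expect n f g : f =1 g -> iid_expect n f = iid_expect n g.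
Proof.
by elim: n f g => //= n IHn f g fg; apply: eq_bigr => v _; congr (_ * _); exact: IHn.
Qed.

Lemma iid_expectD n f g : iid_expect n (fun s => f s + g s) = iid_expect n f + iid_expect n g.
Proof.
elim: n f g => //= n IHn f g; rewrite -big_split; apply: eq_bigr => v _ /=.
by rewrite IHn mulrDr.
Qed.

Lemma iid_expectZ n a f : iid_expect n (fun s => a * f s) = a * iid_expect n f.
Proof.
elim: n f => //= n IHn f; rewrite big_distrr; apply: eq_bigr => v _ /=.
by rewrite IHn mulrCA.
Qed.

Lemma iid_expect_cst n a : iid_expect n (fun=> a) = a.
Proof.
by elim: n => //= n IHn; rewrite -[RHS]mul1r -p_sum1 mulr_suml; under eq_bigr do rewrite IHn.
Qed.

Lemma le_iid_expect n f g : (forall s, f s <= g s) -> iid_expect n f <= iid_expect n g.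
Proof.
elim: n f g => //= n IHn f g fg; apply: ler_sum => v _.
by apply: ler_wpM2l => //; exact: IHn.
Qed.

Definition seq_sum phi (s : seq T) : R := \sum_(v <- s) phi v.

(* Given the other observations, h is constant on the support of psi, on which
   the centred psi integrates to 0. *)
Lemma iid_expect_orthogonal n psi h : \sum_v p v * psi v = 0 ->
    (forall s1 v w s2, psi v != 0 -> psi w != 0 ->
      h (s1 ++ v :: s2) = h (s1 ++ w :: s2)) ->
  iid_expect n (fun s => seq_sum psi s * h s) = 0.
Proof.
move=> psi0; elim: n h => [|n IHn] h hE /=; first by rewrite /seq_sum big_nil mul0r.
pose H v := iid_expect n (fun s => h (v :: s)).
have -> : \sum_v p v * iid_expect n (fun s => seq_sum psi (v :: s) * h (v :: s)) =
    \sum_v p v * psi v * H v.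
  apply: eq_bigr => v _; rewrite -mulrA; congr (_ * _).
  transitivity (iid_expect n (fun s => psi v * h (v :: s) + seq_sum psi s * h (v :: s))).
    by apply: eq_iid_expect => s; rewrite /seq_sum big_cons mulrDl.
  rewrite iid_expectD iid_expectZ IHn ?addr0// => s1 x w s2 psix psiw.
  exact: (hE (v :: s1)).
case: (pickP (fun v => psi v != 0)) => [w psiw|psiE]; last first.
  by rewrite big1// => v _; move/negbFE/eqP : (psiE v) => ->; rewrite mulr0 mul0r.
rewrite (eq_bigr (fun v => p v * psi v * H w)); last first.
  move=> v _; have [->|psiv] := eqVneq (psi v) 0; first by rewrite mulr0 !mul0r.
  by congr (_ * _); apply: eq_iid_expect => s; exact: (hE [::]).
by rewrite -mulr_suml psi0 mul0r.
Qed.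

Lemma iid_expect_seq_sum2 n phi : \sum_v p v * phi v = 0 ->
  iid_expect n (fun s => seq_sum phi s ^+ 2) = n%:R * \sum_v p v * phi v ^+ 2.
Proof.
move=> phi0; elim: n => [|n IHn]; first by rewrite /= /seq_sum big_nil expr0n mul0r.
have S0 : iid_expect n (seq_sum phi) = 0.
  rewrite -(@iid_expect_orthogonal n phi (fun=> 1))//.
  by apply: eq_iid_expect => s; rewrite mulr1.
have E v : iid_expect n (fun s => seq_sum phi (v :: s) ^+ 2) =
    phi v ^+ 2 + n%:R * \sum_v p v * phi v ^+ 2.
  transitivity (iid_expect n (fun s => (phi v ^+ 2 + (2 * phi v) * seq_sum phi s)
                                 + seq_sum phi s ^+ 2)).
    by apply: eq_iid_expect => s; rewrite /seq_sum big_cons; ring.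
  by rewrite !iid_expectD iid_expectZ S0 mulr0 addr0 IHn iid_expect_cst.
rewrite /=; under eq_bigr do rewrite E mulrDr.
by rewrite big_split/= -mulr_suml p_sum1; ring.
Qed.

End finite_iid.

Section tail_ratio_martingale.
Context {R : realFieldType} {T : finType} (p : T -> R).
Context (p_ge0 : forall v, 0 <= p v) (p_sum1 : \sum_v p v = 1).
Context (a : nat -> pred T) (a_decr : forall k v, a k.+1 v -> a k v).

Let q k := \sum_v p v * (a k v)%:R.
(** Summed over a sample, [phi k] gives the tail ratio N_k / q_k minus the sample size, where N_k
    counts the observations in [a k]. The index k plays the role of time. *)
Let phi k v : R := (a k v)%:R / q k - 1.

Context (n K : nat) (eps : R).
Context (q_gt0 : forall k, (k <= K)%N -> 0 < q k) (eps_ge0 : 0 <= eps).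

Let D k (s : seq T) := seq_sum (phi k) s.
Let B k (s : seq T) := has (fun j => eps <= `|D j s|) (iota 0 k.+1).

Let phi_centered k : (k <= K)%N -> \sum_v p v * phi k v = 0.
Proof.
move=> kK; have qk0 := q_gt0 kK.
rewrite /phi; under eq_bigr do rewrite mulrBr mulr1 mulrA.
by rewrite sumrB -mulr_suml p_sum1 divff ?subrr// gt_eqF.
Qed.

Let a_le j k v : (j <= k)%N -> a k v -> a j v.
Proof.
move=> /subnK <-; elim: (k - j)%N => // m IHm; rewrite addSn => /a_decr; exact: IHm.
Qed.

(** An observation of [a k] lies in every earlier [a j], so moving it within [a k] leaves the past
    of the process unchanged. This stands in for adaptedness to a filtration. *)
Let D_le_const j k s1 v w s2 : (j <= k)%N -> a k v -> a k w ->
  D j (s1 ++ v :: s2) = D j (s1 ++ w :: s2).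
Proof.
move=> jk kv kw; rewrite /D /seq_sum !big_cat !big_cons /phi.
by rewrite (a_le jk kv) (a_le jk kw).
Qed.

Let B_const k s1 v w s2 : a k v -> a k w ->
  B k (s1 ++ v :: s2) = B k (s1 ++ w :: s2).
Proof.
move=> kv kw; apply: eq_in_has => j; rewrite mem_iota add0n ltnS => jk.
by rewrite (D_le_const _ _ jk kv kw).
Qed.

(** The increment [psi] is centred and vanishes off [a k], where [phi k] and [phi k.+1] are both -1.
    Orthogonality to the past, crossing event included, kills the cross term and leaves the square
    of the increment. *)
Let submartingale k : (k < K)%N ->
  iid_expect p n (fun s => D k s ^+ 2 * (B k s)%:R) <=
  iid_expect p n (fun s => D k.+1 s ^+ 2 * (B k s)%:R).
Proof.
move=> kK; pose psi v := phi k.+1 v - phi k v.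
have psi_supp v : psi v != 0 -> a k v.
  apply: contra_neqT => /negbTE kv; rewrite /psi /phi kv.
  by case: (boolP (a k.+1 v)) => [/a_decr|_]; rewrite ?kv// !mul0r subrr.
have DE s : D k.+1 s = D k s + seq_sum psi s.
  by rewrite /D /seq_sum -big_split; apply: eq_bigr => v _; rewrite /psi /= addrC subrK.
have psi0 : \sum_v p v * psi v = 0.
  under eq_bigr do rewrite mulrBr.
  by rewrite sumrB !phi_centered ?subrr// ltnW.
have orth : iid_expect p n (fun s => seq_sum psi s * (2 * D k s * (B k s)%:R)) = 0.
  apply: iid_expect_orthogonal => // s1 v w s2 /psi_supp kv /psi_supp kw.
  by rewrite (D_le_const _ _ (leqnn k) kv kw) (B_const _ _ kv kw).
rewrite -[leLHS]addr0 -orth -iid_expectD; apply: le_iid_expect => // s.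
rewrite DE -subr_ge0 (_ : _ - _ = seq_sum psi s ^+ 2 * (B k s)%:R); last by ring.
by rewrite mulr_ge0 ?sqr_ge0.
Qed.

(** Decomposition according to the first crossing: an earlier crossing is carried along by
    [submartingale], and for a first crossing at time k + 1 the square of [D k.+1] is itself at
    least eps^2. *)
Let doob k : (k <= K)%N ->
  eps ^+ 2 * iid_expect p n (fun s => (B k s)%:R) <=
  iid_expect p n (fun s => D k s ^+ 2 * (B k s)%:R).
Proof.
have sqD j s : eps <= `|D j s| -> eps ^+ 2 <= D j s ^+ 2.
  by move=> epsD; rewrite -(real_normK (num_real (D j s))) lerXn2r// nnegrE.
elim: k => [_|k IHk kK].
  rewrite -iid_expectZ; apply: le_iid_expect => // s; rewrite /B /= orbF.
  by case: (boolP (eps <= `|D 0 s|)) => [/sqD|_]; rewrite ?mulr1// !mulr0.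
have BS s : B k.+1 s = B k s || (eps <= `|D k.+1 s|).
  by rewrite /B -(addn1 k.+1) iotaD has_cat /= orbF add0n.
have := IHk (ltnW kK); move/le_trans/(_ (submartingale kK)) => {}IHk.
pose N s := (~~ B k s && (eps <= `|D k.+1 s|))%:R : R.
have BN s : (B k.+1 s)%:R = (B k s)%:R + N s.
  by rewrite BS /N; case: (B k s) => /=; rewrite ?addr0 ?add0r.
rewrite (eq_iid_expect p n BN) iid_expectD mulrDr.
rewrite [leRHS](@eq_iid_expect _ _ _ _ _ (fun s => D k.+1 s ^+ 2 * (B k s)%:R + D k.+1 s ^+ 2 * N s)).
  rewrite iid_expectD; apply: lerD => //; rewrite -iid_expectZ; apply: le_iid_expect => // s.
  rewrite /N; case: (boolP (eps <= `|D k.+1 s|)) => [/sqD|_]; last by rewrite andbF !mulr0.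
  by move=> ?; apply: ler_wpM2r.
by move=> s; rewrite BN mulrDr.
Qed.

Lemma tail_ratio_maximal :
  eps ^+ 2 * iid_expect p n (fun s =>
    (has (fun k => eps <= `|(count (a k) s)%:R / q k - (size s)%:R|) (iota 0 K.+1))%:R)
  <= n%:R * ((1 - q K) / q K).
Proof.
have DE k s : D k s = (count (a k) s)%:R / q k - (size s)%:R.
  rewrite /D /seq_sum /phi sumrB -mulr_suml; congr (_ / _ - _).
    rewrite -natr_sum; congr (_%:R); rewrite -sum1_count [RHS]big_mkcond.
    by apply: eq_bigr => v _; case: (a k v).
  by rewrite -sum1_size natr_sum.
apply: (le_trans (y := eps ^+ 2 * iid_expect p n (fun s => (B K s)%:R))).
  apply: ler_wpM2l; first exact: exprn_ge0.
  apply: le_iid_expect => // s; rewrite ler_nat; apply/eq_leq; congr nat_of_bool.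
  by apply: eq_has => k; rewrite DE.
apply: (le_trans (doob (leqnn K))).
apply: (le_trans (y := iid_expect p n (fun s => D K s ^+ 2))).
  by apply: le_iid_expect => // s; case: (B K s); rewrite ?mulr1 ?mulr0 ?sqr_ge0.
rewrite iid_expect_seq_sum2 ?phi_centered// (_ : \sum_v _ = (1 - q K) / q K)//.
have qK := q_gt0 (leqnn K).
(* The indicator is idempotent, so the square of [phi K] is affine in it, and its mean is 1 / q - 1
   with q = [q K]. *)
transitivity (\sum_v (p v * (a K v)%:R * ((q K)^-1 ^+ 2 - 2 / q K) + p v)).
  apply: eq_bigr => v _; rewrite /phi; case: (a K v) => /=; ring.
rewrite big_split/= -mulr_suml p_sum1 -/(q K).
by field; rewrite gt_eqF.
Qed.

End tail_ratio_martingale.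

(** * Maximal inequality for the empirical tail *)

Lemma measure_bigcup_fin d (T : measurableType d) (R : realType) (S : finType)
    (mu : {measure set T -> \bar R}) (A : S -> set T) :
    (forall v, measurable (A v)) -> trivIset setT A ->
  mu (\bigcup_v A v) = (\sum_v mu (A v))%E.
Proof.
move=> mA tA; rewrite measure_fin_bigcup//.
  rewrite fsbig_finite; last exact: finite_finset.
  rewrite -[RHS]big_enum; apply: perm_big; apply: uniq_perm.
  - exact: finmap.fset_uniq.
  - exact: enum_uniq.
  move=> v; rewrite in_fset_set; last exact: finite_finset.
  by rewrite mem_enum in_setT.
exact: finite_finset.
Qed.

(** Quantisation by [cell] carries events on n-tuples to the finite model. Measurability and value
    go together because the induction works on the sections [A (v :: _)], whose measurability it has
    to supply. *)
Lemma finite_iid_law d (T : measurableType d) (R : realType) (S : finType)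
    (P : probability T R) (cell : T -> S) n (A : pred (seq S)) :
    (forall v, measurable (cell @^-1` [set v])) ->
  measurable [set X : n.-tuple T | A (map cell X)] /\
  iid_law P n [set X | A (map cell X)] =
    (iid_expect (fun v => fine (P (cell @^-1` [set v]))) n (fun s => (A s)%:R))%:E.
Proof.
move=> mcell; elim: n A => [|n IHn] A.
  split.
    rewrite (_ : [set _ | _] = if A [::] then setT else set0).
      by case: ifP => _; [exact: measurableT|exact: measurable0].
    by apply/seteqP; split=> X /=; rewrite (tuple0 X) /=; case: (A [::]).
  by rewrite /= diracE /=; congr ((nat_of_bool _)%:R%:E); apply/idP/idP => [/set_mem//|?]; exact/mem_set.
pose B v := [set X : n.-tuple T | A (v :: map cell X)].
have mB v : measurable (B v) by case: (IHn (fun s => A (v :: s))).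
pose C v := cell @^-1` [set v] `*` B v.
have mC v : measurable (C v) by apply: measurableX.
have tC : trivIset setT C.
  apply/trivIsetP => v w _ _ /eqP vw; rewrite -subset0 => -[x X] [].
  by move=> [/= xv _] [/= xw _]; apply: vw; rewrite -xv.
have preE : @cons_pair _ T n @^-1` [set X | A (map cell X)] = \bigcup_v C v.
  apply/seteqP; split=> [[x X] /= AxX|[x X] [v _ [/= <- BX]]]; last exact: BX.
  by exists (cell x).
split.
  rewrite (_ : [set _ | _] = \bigcup_v
      (((fun X : n.+1.-tuple T => cell (tnth X ord0)) @^-1` [set v])
        `&` ((fun X : n.+1.-tuple T => [tuple of behead X]) @^-1` B v))).
    apply: fin_bigcup_measurable; first exact: finite_finset.
    move=> v _; apply: measurableI.
      rewrite -[X in measurable X]setTI.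
      exact: (measurable_tnth ord0 measurableT (mcell v)).
    rewrite -[X in measurable X]setTI.
    exact: (measurable_behead measurableT (mB v)).
  apply/seteqP; split=> X /=.
    by case/tupleP: X => x X /= AX; exists (cell x).
  by move=> [v _ []]; case/tupleP: X => x X /=; rewrite /B /= => <-.
rewrite /= /distribution /pushforward preE.
rewrite measure_bigcup_fin// -sumEFin; apply: eq_bigr => v _.
transitivity (P (cell @^-1` [set v]) * iid_law P n (B v))%E.
  exact: product_measure1E.
rewrite EFinM fineK ?fin_num_measure//; congr (_ * _)%E.
by case: (IHn (fun s => A (v :: s))).
Qed.

Lemma finite_pushforward d (T : measurableType d) (R : realType) (S : finType)
    (P : probability T R) (cell : T -> S) (A : pred S) :
    (forall v, measurable (cell @^-1` [set v])) ->
  P [set x | A (cell x)] = (\sum_v fine (P (cell @^-1` [set v])) * (A v)%:R)%:E.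
Proof.
move=> mcell.
pose B v := cell @^-1` [set v] `&` [set _ | A v].
have mB v : measurable (B v).
  rewrite /B; case: (A v).
    by rewrite (_ : [set _ | _] = setT) ?setIT//; apply/seteqP; split.
  by rewrite (_ : [set _ | _] = set0) ?setI0//; apply/seteqP; split.
rewrite (_ : [set x | _] = \bigcup_v B v).
  rewrite measure_bigcup_fin//; last first.
    apply/trivIsetP => v w _ _ /eqP vw; rewrite -subset0 => x [].
    by move=> [/= xv _] [/= xw _]; apply: vw; rewrite -xv.
  rewrite -sumEFin; apply: eq_bigr => v _; rewrite /B; case: (A v).
    rewrite (_ : [set _ | _] = setT) ?setIT ?mulr1 ?fineK ?fin_num_measure//.
    by apply/seteqP; split.
  by rewrite (_ : [set _ | _] = set0) ?setI0 ?mulr0 ?measure0//; apply/seteqP; split.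
by apply/seteqP; split=> x /=; [exists (cell x)|move=> [v _ []] /= <-].
Qed.

Definition ntail (R : realType) n (X : n.-tuple (measurableTypeR R)) (q : R) : nat :=
  count (fun x : R => q < x) X.

Lemma df_tail (R : realType) (P : probability (measurableTypeR R) R) (F : R -> R) x :
  has_df P F -> P [set y : R | x < y] = (1 - F x)%:E.
Proof.
move=> PF; rewrite (_ : [set y | _] = ~` `]-oo, x]%classic).
  by rewrite probability_setC// PF EFinB.
by rewrite setCitvl; apply/seteqP; split=> y /=; rewrite in_itv/= andbT.
Qed.

Lemma measurable_ntail (R : realType) n (V : pred nat) (q : R) :
  measurable [set X : n.-tuple (measurableTypeR R) | V (ntail X q)].
Proof.
pose cell (x : measurableTypeR R) : bool := q < x.
have mcell v : measurable (cell @^-1` [set v]).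
  have E : cell @^-1` [set true] = `]q, +oo[%classic.
    by apply/seteqP; split=> x /=; rewrite in_itv/= andbT.
  case: v; first by rewrite E.
  rewrite (_ : _ @^-1` _ = ~` (cell @^-1` [set true])).
    by rewrite E; exact: measurableC.
  by apply/seteqP; split=> x /=; case: (cell x).
(* Measurability is read off from [finite_iid_law] with two cells and a Dirac mass as an arbitrary
   law. *)
have [] := @finite_iid_law _ _ R _ (dirac point) cell n (fun s => V (count id s)) mcell.
by under [in X in X -> _]eq_set do rewrite count_map.
Qed.

Lemma measurable_has_ntail (R : realType) n (V : R -> nat -> bool) (xs : seq R) :
  measurable [set X : n.-tuple (measurableTypeR R) | has (fun q => V q (ntail X q)) xs].
Proof.
elim: xs => [|q xs IHxs] /=; first by rewrite (_ : [set _ | _] = set0)//; apply/seteqP; split.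
rewrite (_ : [set _ | _] = [set X : n.-tuple (measurableTypeR R) | V q (ntail X q)] `|`
  [set X | has (fun q => V q (ntail X q)) xs]).
  by apply: measurableU => //; exact: measurable_ntail.
by apply/seteqP; split=> X /= /orP.
Qed.

Lemma df_nondecreasing (R : realType) (P : probability (measurableTypeR R) R) (F : R -> R) :
  has_df P F -> {homo F : x y / x <= y}.
Proof.
move=> PF x y xy; rewrite -lee_fin -!PF; apply: le_measure; rewrite ?inE//.
exact: subset_itvl.
Qed.

(** The event depends on each observation only through its position relative to finitely many
    points, so the finite maximal inequality applies at level n eps. The point b is added to [xs] as
    the largest one, which makes the variance at b appear and keeps the bound independent of
    [xs]. *)
Lemma ntail_maximal (R : realType) (P : probability (measurableTypeR R) R)
    (F : R -> R) n (xs : seq R) (b eps : R) :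
    has_df P F -> F b < 1 -> 0 < eps -> (0 < n)%N ->
    all (fun x => x <= b) xs ->
  let bad := [set X : n.-tuple (measurableTypeR R) |
      has (fun q : R => eps * (1 - F q) <=
        `|(ntail X q)%:R / n%:R - (1 - F q)|)%R xs] in
  measurable bad /\
  (iid_law P n bad <= (F b / (n%:R * eps ^+ 2 * (1 - F b)))%:E)%E.
Proof.
move=> PF Fb1 eps0 n0 xsb bad.
pose ys := sort <=%R (b :: xs); pose K := size xs.
have sys : size ys = K.+1 by rewrite size_sort.
have Fnd := df_nondecreasing PF.
have ysb k : (k <= K)%N -> nth 0 ys k <= b.
  move=> kK; have : nth 0 ys k \in ys by rewrite mem_nth ?sys.
  by rewrite mem_sort inE => /predU1P[->//|/(allP xsb)].
have ysK : nth 0 ys K = b.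
  apply/eqP; rewrite eq_le ysb//=.
  have : b \in ys by rewrite mem_sort inE eqxx.
  move=> /(nthP 0)[j]; rewrite sys ltnS => jK <-.
  apply: sorted_leq_nth; rewrite ?inE ?sys//; first exact: le_trans.
  exact: sort_le_sorted.
(* In the sorted list this counts the points strictly below x: K + 1 points cut the line into K + 2
   cells, and x exceeds the k-th point exactly when k < [first x]. *)
pose first (x : R) := find (fun y => x <= y) ys.
have first_lt k x : (k <= K)%N -> (k < first x)%N = (nth 0 ys k < x).
  move=> kK; apply/idP/idP => [/(before_find 0)/=|kx]; first by rewrite ltNge => ->.
  rewrite ltnNge; apply/negP => fk.
  have fs : (first x < size ys)%N by rewrite sys ltnS (leq_trans fk).
  have := fs; rewrite -has_find => /(nth_find 0) /= xf.
  have : nth 0 ys (first x) <= nth 0 ys k.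
    apply: sorted_leq_nth; rewrite ?inE ?sys//; first exact: le_trans.
      exact: sort_le_sorted.
    by rewrite -sys.
  by move=> /(le_trans xf); rewrite leNgt kx.
have first_le x : (first x < K.+2)%N by rewrite ltnS -sys find_size.
pose cell (x : measurableTypeR R) : 'I_K.+2 := Ordinal (first_le x).
have mlt k : measurable [set x : measurableTypeR R | (k < first x)%N].
  have [kK|kK] := leqP k K.
    rewrite (_ : [set _ | _] = `]nth 0 ys k, +oo[%classic)//.
    by apply/seteqP; split=> x /=; rewrite in_itv/= andbT first_lt.
  rewrite (_ : [set _ | _] = set0)//; apply/seteqP; split=> x //=.
  by rewrite ltnNge (leq_trans _ kK)// -ltnS.
have mcell v : measurable (cell @^-1` [set v]).
  have -> : cell @^-1` [set v] = [set x | (v <= first x)%N] `\` [set x | (v < first x)%N].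
    apply/seteqP; split=> x /=; first by move=> <- /=; rewrite ltnn leqnn.
    by move=> [vx /negP]; rewrite -leqNgt => xv; apply/val_inj/eqP; rewrite eqn_leq /= xv vx.
  apply: measurableD => //; case: (nat_of_ord v) => // .
  by rewrite (_ : [set _ | _] = setT)//; apply/seteqP; split.
pose p v := fine (P (cell @^-1` [set v])).
have p0 v : 0 <= p v by rewrite fine_ge0.
have p1 : \sum_v p v = 1.
  apply: EFin_inj; rewrite -[RHS](probability_setT P).
  have := finite_pushforward P (fun=> true) mcell.
  rewrite (_ : [set _ | _] = setT)//; last by apply/seteqP; split.
  by move=> ->; congr EFin; apply: eq_bigr => v _; rewrite mulr1.
pose a k (v : 'I_K.+2) := (k < v)%N.
have q_tail k : (k <= K)%N -> \sum_v p v * (a k v)%:R = 1 - F (nth 0 ys k).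
  move=> kK; apply: EFin_inj; rewrite -(df_tail _ PF).
  rewrite -(finite_pushforward P (a k) mcell); congr (P _).
  by apply/seteqP; split=> x /=; rewrite /a/= first_lt.
have q0 k : (k <= K)%N -> 0 < \sum_v p v * (a k v)%:R.
  by move=> kK; rewrite q_tail// subr_gt0 (le_lt_trans _ Fb1)// Fnd// ysb.
pose A (s : seq 'I_K.+2) :=
  has (fun k => n%:R * eps <= `|(count (a k) s)%:R / (\sum_v p v * (a k v)%:R)
                               - (size s)%:R|) (iota 0 K.+1).
pose Abad := [set X : n.-tuple (measurableTypeR R) | A (map cell X)].
have n0R : 0 < n%:R :> R by rewrite ltr0n.
have badE : bad `<=` Abad.
  move=> X /hasP[q qxs]; rewrite -subr_ge0 => Hq.
  have : q \in ys by rewrite mem_sort inE qxs orbT.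
  move=> /(nthP 0)[k]; rewrite sys ltnS => kK qE.
  apply/hasP; exists k; first by rewrite mem_iota.
  have qk0 : 0 < 1 - F q by rewrite -qE -q_tail// q0.
  have -> : count (a k) (map cell X) = ntail X q.
    rewrite count_map; apply: eq_count => x.
    by rewrite /a /= first_lt// qE.
  rewrite q_tail// qE size_map size_tuple.
  have -> : (ntail X q)%:R / (1 - F q) - n%:R =
      (n%:R / (1 - F q)) * ((ntail X q)%:R / n%:R - (1 - F q)).
    by field; rewrite !gt_eqF.
  rewrite normrM gtr0_norm ?divr_gt0// mulrAC ler_pdivlMr// -mulrA ler_pM2l//.
  by rewrite -subr_ge0.
have [mA PA] := finite_iid_law P n A mcell.
have mbad : measurable bad.
  exact: (@measurable_has_ntail _ n
    (fun q m => eps * (1 - F q) <= `|m%:R / n%:R - (1 - F q)|) xs).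
split => //.
apply: (@le_trans _ _ (iid_law P n Abad)).
  by apply: le_measure => //; rewrite inE.
rewrite /Abad PA lee_fin.
have Fb0 : 0 < 1 - F b by rewrite subr_gt0.
have neps : 0 < (n%:R * eps) ^+ 2 by rewrite exprn_gt0// mulr_gt0.
have a_decr k v : a k.+1 v -> a k v by apply: ltn_trans.
have neps0 : 0 <= n%:R * eps by rewrite mulr_ge0// ltW.
have := @tail_ratio_maximal _ _ p p0 p1 a a_decr n K (n%:R * eps) q0 neps0.
rewrite q_tail// ysK [leLHS]mulrC -ler_pdivlMr// => /le_trans; apply.
rewrite le_eqVlt; apply/orP; left; apply/eqP.
by field; rewrite !gt_eqF.
Qed.

(** * Tests based on the empirical tail *)

Lemma set_test (R : realType) n (A : set (n.-tuple (measurableTypeR R))) :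
  measurable A -> exists Psi : test n, forall X, Psi X = `[< A X >].
Proof.
move=> mA; pose f X := `[< A X >].
have mf : measurable_fun setT f.
  apply: (measurable_fun_bool true).
  rewrite setTI (_ : _ @^-1` _ = A)//.
  by apply/seteqP; split=> X /=; [move=> /asboolP|move=> ?; exact/asboolP].
pose Psi : test n := HB.pack f (isMeasurableFun.Build _ _ _ _ f mf).
by exists Psi.
Qed.

Lemma sup_risk_le (R : realType) n (H : set (R -> R))
    (f : n.-tuple (measurableTypeR R) -> R) (c : R) : 0 <= c ->
    (forall P F, H F -> has_df P F -> ('E_(iid_law P n)[f] <= c%:E)%E) ->
  (sup_risk H f <= c%:E)%E.
Proof.
move=> c0 Hc; rewrite /sup_risk ge_max lee_fin c0 /=.
by apply: ge_ereal_sup => _ [P [F HF PF] <-]; exact: Hc PF.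
Qed.

(** Enumeration of the rationals, with 0 for codes that decode to nothing. Rejection regions become
    countable unions, hence measurable. *)
Definition rat_seq (R : realType) (k : nat) : R := ratr (odflt 0 (unpickle k)).

Lemma rat_seqP (R : realType) (x y : R) : x < y -> exists2 k, x < rat_seq R k & rat_seq R k < y.
Proof.
move=> xy; have [r] := rat_in_itvoo xy; rewrite in_itv/= => /andP[xr ry].
by exists (pickle r); rewrite /rat_seq pickleK.
Qed.

Definition tail_region (R : realType) n (b : R) (V : R -> R -> bool) :
    set (n.-tuple (measurableTypeR R)) :=
  [set X | exists2 k, 0 < rat_seq R k <= b &
    V (rat_seq R k) ((ntail X (rat_seq R k))%:R / n%:R)].

Lemma measurable_tail_region (R : realType) n (b : R) V :
  measurable (@tail_region R n b V).
Proof.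
rewrite (_ : tail_region _ _ = \bigcup_k [set X : n.-tuple (measurableTypeR R) |
    (fun m => (0 < rat_seq R k <= b) && V (rat_seq R k) (m%:R / n%:R))
      (ntail X (rat_seq R k))]).
  apply: bigcupT_measurable => k.
  exact: (measurable_ntail (fun m => (0 < rat_seq R k <= b) && V (rat_seq R k) (m%:R / n%:R))).
apply/seteqP; split=> X [k] /=; first by exists k => //=; apply/andP.
by move=> _ /andP[]; exists k.
Qed.

(** The maximal inequality at the single point q has right-hand side 0 since F q = 0. With eps = 1 /
    n its event contains every sample with a missing observation, a wrong count being off by at
    least 1. *)
Lemma ntail_full (R : realType) (P : probability (measurableTypeR R) R)
    (F : R -> R) n (q : R) : has_df P F -> (0 < n)%N -> F q = 0 ->
  iid_law P n [set X | ntail X q != n] = 0%E.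
Proof.
move=> PF n0 Fq0; have n0R : 0 < n%:R :> R by rewrite ltr0n.
have [] := @ntail_maximal R P F n [:: q] q n%:R^-1 PF; rewrite ?Fq0 ?invr_gt0//=.
  by rewrite lexx.
rewrite mul0r => mB B0.
apply/eqP; rewrite eq_le measure_ge0 andbT (le_trans _ B0)//.
apply: le_measure; rewrite ?inE//; first exact: (measurable_ntail (fun m => m != n)).
move=> X /= Nn; rewrite orbF Fq0 subr0 mulr1.
have -> : (ntail X q)%:R / n%:R - 1 = ((ntail X q)%:R - n%:R) / n%:R :> R.
  by field; rewrite gt_eqF.
rewrite normrM [`|_^-1|]gtr0_norm ?invr_gt0// ler_pMl ?invr_gt0//.
rewrite distrC -[X in X%:R - _](subnKC (_ : (ntail X q <= n)%N)); last first.
  by rewrite -[leqRHS](size_tuple X) count_size.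
rewrite natrD addrAC subrr add0r ger0_norm// ler1n subn_gt0.
by rewrite ltn_neqAle Nn -[leqRHS](size_tuple X) count_size.
Qed.

(** The bound of [ntail_maximal] does not depend on the number of points, so it survives the
    increasing limit over finite sets of rationals. Points with F q = 0, about which the classes say
    nothing, are covered by a null set off which the empirical tail equals 1. *)
Lemma tail_region_null (R : realType) (P : probability (measurableTypeR R) R)
    (F : R -> R) n (b eps : R) (V : R -> R -> bool) :
    has_df P F -> F b < 1 -> 0 < eps -> (0 < n)%N ->
    (forall q t, 0 < q <= b -> (F q = 0 -> t = 1) ->
      `|t - (1 - F q)| <= eps * (1 - F q) -> ~~ V q t) ->
  (iid_law P n (tail_region b V) <= (F b / (n%:R * eps ^+ 2 * (1 - F b)))%:E)%E.
Proof.
move=> PF Fb1 eps0 n0 HV.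
have n0R : 0 < n%:R :> R by rewrite ltr0n.
pose e := rat_seq R; set c := (X in (_ <= X)%E).
pose Z := \bigcup_k [set X : n.-tuple (measurableTypeR R) |
  (F (e k) == 0) && (ntail X (e k) != n)].
pose far (q : R) (m : nat) := eps * (1 - F q) <= `|m%:R / n%:R - (1 - F q)|.
pose D N := [set X : n.-tuple (measurableTypeR R) |
  has (fun q => far q (ntail X q)) [seq q <- map e (iota 0 N) | q <= b]].
have mZ : measurable Z.
  by apply: bigcupT_measurable => k; exact: (measurable_ntail (fun m => (F (e k) == 0) && (m != n))).
have mD N : measurable (D N) by exact: (measurable_has_ntail far).
have mUD : measurable (\bigcup_N D N) by exact: bigcupT_measurable.
have Z0 : iid_law P n Z = 0%E.
  apply/eqP; rewrite eq_le measure_ge0 andbT.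
  apply: (le_trans (generalized_Boole_inequality _ _ mZ)).
    by move=> k; exact: (measurable_ntail (fun m => (F (e k) == 0) && (m != n))).
  rewrite eseries0// => k _ _ /=.
  have [Fk0|Fk0] := eqVneq (F (e k)) 0; first exact: (ntail_full PF n0 Fk0).
  rewrite [X in iid_law P n X](_ : _ = set0) ?measure0//.
  by apply/seteqP; split=> X //=; rewrite (negbTE Fk0).
have Dc : (iid_law P n (\bigcup_N D N) <= c)%E.
  have cvgD : (iid_law P n \o D) x @[x --> \oo] --> iid_law P n (\bigcup_N D N).
    apply: nondecreasing_cvg_mu => // N M NM; apply/subsetPset => X /hasP[q].
    rewrite mem_filter => /andP[qb] /mapP[k]; rewrite mem_iota/= => kN qE Hq.
    apply/hasP; exists q => //; rewrite mem_filter qb/=; apply/mapP; exists k => //.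
    by rewrite mem_iota/= (leq_trans kN).
  rewrite -(cvg_lim _ cvgD)//; apply: lime_le; first by apply/cvg_ex; eexists; exact: cvgD.
  apply: nearW => N; have [] := @ntail_maximal R P F n
    [seq q <- map e (iota 0 N) | q <= b] b eps PF Fb1 eps0 n0 (filter_all _ _) => _.
  exact.
apply: (@le_trans _ _ (iid_law P n (Z `|` \bigcup_N D N))).
  apply: le_measure; rewrite ?inE; [exact: measurable_tail_region|exact: measurableU|].
  move=> X [k /andP[k0 kb]] Vk; apply: contrapT => /not_orP[nZ nD].
  move: Vk; apply/negP; apply: HV; rewrite ?k0//.
  - move=> Fk0; have /eqP -> : ntail X (e k) == n; last by rewrite divff// gt_eqF.
    by apply/negPn/negP => Nn; apply: nZ; exists k => //=; rewrite Fk0 eqxx.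
  - rewrite leNgt; apply/negP => /ltW Hk; apply: nD; exists k.+1 => //.
    apply/hasP; exists (e k) => //; rewrite mem_filter kb; apply/mapP; exists k => //.
    by rewrite mem_iota/=.
apply: (le_trans (measureU2 _ mZ mUD)); rewrite -[leRHS]add0e.
by apply: leeD => //; rewrite le_eqVlt; apply/orP; left; apply/eqP.
Qed.

(** A single rational is enough for power; the bound is nevertheless taken at b, so that both error
    probabilities share it. *)
Lemma tail_region_alt (R : realType) (P : probability (measurableTypeR R) R)
    (F : R -> R) n (b eps : R) (V : R -> R -> bool) k :
    has_df P F -> F b < 1 -> 0 < eps -> (0 < n)%N -> 0 < rat_seq R k <= b ->
    (forall t, `|t - (1 - F (rat_seq R k))| <= eps * (1 - F (rat_seq R k)) ->
      V (rat_seq R k) t) ->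
  (iid_law P n (~` tail_region b V) <= (F b / (n%:R * eps ^+ 2 * (1 - F b)))%:E)%E.
Proof.
move=> PF Fb1 eps0 n0 /andP[k0 kb] HV.
have [] := @ntail_maximal R P F n [:: rat_seq R k] b eps PF Fb1 eps0 n0.
  by rewrite /= kb.
move=> mB; apply: le_trans; apply: le_measure; rewrite ?inE//.
  by apply: measurableC; exact: measurable_tail_region.
move=> X nX /=; rewrite orbF leNgt; apply/negP => /ltW Hk; apply: nX.
by exists k; [rewrite k0|exact: HV].
Qed.

Lemma tail_region_test (R : realType) n (b : R) (V : R -> R -> bool) :
  exists Psi : test n, forall P : probability (measurableTypeR R) R,
    ('E_(iid_law P n)[(fun X => (Psi X)%:R)%R] = iid_law P n (tail_region b V))%E /\
    ('E_(iid_law P n)[(fun X => 1 - (Psi X)%:R)%R]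
      = iid_law P n (~` tail_region b V))%E.
Proof.
have mA := @measurable_tail_region R n b V.
have [Psi PsiE] := set_test mA; exists Psi => P; split.
  rewrite -expectation_indic//; congr expectation; apply/funext => X.
  by rewrite PsiE indicE; congr (nat_of_bool _)%:R; apply/asboolP/idP => [/mem_set|/set_mem].
rewrite -expectation_indic; last exact: measurableC.
congr expectation; apply/funext => X; rewrite PsiE indicE in_setC.
rewrite (_ : `[< _ >] = (X \in tail_region b V)).
  by case: (X \in _); rewrite ?subrr ?subr0.
by apply/asboolP/idP => [/mem_set|/set_mem].
Qed.

(** * Distribution functions *)

Section df_facts.
Context (R : realType) (P : probability (measurableTypeR R) R) (F : R -> R).
Context (PF : has_df P F).

(** The identity random variable under P gives access to the right continuity and the limits of
    [cdf]. *)
Lemma df_cdf : exists X : {RV P >-> R}, cdf X = EFin \o F.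
Proof.
pose f := idfun : measurableTypeR R -> R.
have mf : measurable_fun setT f by exact: measurable_id.
pose X : {RV P >-> R} := HB.pack f (isMeasurableFun.Build _ _ _ _ f mf).
exists X; apply/funext => r; rewrite /= -PF /cdf /distribution /pushforward.
by congr (P _); apply/seteqP; split.
Qed.

Lemma df_ge0 x : 0 <= F x.
Proof. by rewrite -lee_fin -PF. Qed.

Lemma df_le1 x : F x <= 1.
Proof. by rewrite -lee_fin -PF probability_le1. Qed.

Lemma df_right_continuous x : F y @[y --> x^'+] --> F x.
Proof.
have [X XE] := df_cdf; have := @cdf_right_continuous _ _ _ _ X x.
by rewrite XE => /fine_cvgP[].
Qed.

Lemma df_cvgy : F y @[y --> +oo] --> (1 : R).
Proof. by have [X XE] := df_cdf; have := cvg_cdfy1 X; rewrite XE => /fine_cvgP[]. Qed.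

End df_facts.

Lemma nonneg_df_lt0 (R : realType) (F : R -> R) x : nonneg_df F -> x < 0 -> F x = 0.
Proof.
move=> [P P1 PF] x0; apply/eqP; rewrite eq_le (df_ge0 PF) andbT.
rewrite -lee_fin -PF.
apply: (@le_trans _ _ (P (~` `[0, +oo[%classic))).
  apply: le_measure; rewrite ?inE//; first by apply: measurableC.
  by move=> y /=; rewrite !in_itv/= andbT => yx; apply/negP; rewrite -ltNge (le_lt_trans yx).
by rewrite probability_setC// P1 subee.
Qed.

(** F is realised by its Lebesgue-Stieltjes measure. An atom at 0 is allowed: the open negative
    half-line is exhausted by the half-lines up to -1 / (k + 1), each of mass 0. *)
Lemma nonneg_dfI (R : realType) (F : R -> R) :
    {homo F : x y / x <= y} -> (forall x, F y @[y --> x^'+] --> F x) ->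
    (forall x, x < 0 -> F x = 0) -> F y @[y --> +oo] --> (1 : R) ->
  nonneg_df F.
Proof.
move=> Fnd Frc F0 Fy.
have FNy : F y @[y --> -oo] --> (0 : R).
  apply: (@cvg_trans _ ((fun=> 0 : R) @ -oo)); last exact: cvg_cst.
  apply: near_eq_cvg; near=> y; rewrite F0//.
pose G : cumulativeBounded (0:R) (1:R) := HB.pack F
  (isCumulative.Build R _ R F Fnd Frc) (isCumulativeBounded.Build R 0 1 F FNy Fy).
pose P : probability (measurableTypeR R) R := lebesgue_stieltjes_measure G.
have PF : has_df P F.
  move=> x; exact: (cdf_lebesgue_stieltjes_id G x).
exists P => //.
have -> : `[0, +oo[%classic = ~` `]-oo, (0 : R)[%classic by rewrite setCitvl.
rewrite probability_setC// (_ : P _ = 0%E) ?sube0//.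
rewrite (_ : `]-oo, 0[%classic = \bigcup_k `]-oo, (- k.+1%:R^-1 : R)]%classic).
  apply/eqP; rewrite eq_le measure_ge0 andbT.
  apply: (le_trans (generalized_Boole_inequality _ _ _)) => //.
    by apply: bigcupT_measurable.
  rewrite eseries0// => k _ _; apply: (eq_trans (PF _)).
  by rewrite F0// oppr_lt0 invr_gt0.
apply/seteqP; split=> x /=; rewrite in_itv/=.
  move=> x0; have x'0 : 0 < - x^-1 by rewrite oppr_gt0 invr_lt0.
  exists (Num.truncn (- x^-1)) => //=; rewrite in_itv/= lerNr.
  rewrite -[leRHS]invrK lef_pV2 ?posrE ?ltr0n//.
    by rewrite invrN ltW// truncnS_gt.
  by rewrite invr_gt0 oppr_gt0.
by move=> [k _]; rewrite /= in_itv/= => /le_lt_trans; apply; rewrite oppr_lt0 invr_gt0.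
Unshelve. all: by end_near. Qed.

Lemma powR_continuous_at (R : realType) (a x : R) : 0 < x ->
  (y `^ a) @[y --> x] --> x `^ a.
Proof.
move=> x0; have [d _] := is_derive1_powR a x0.
by move/derivable1_diffP : d => /differentiable_continuous.
Qed.

Lemma powR_cvg_right (R : realType) (a x : R) : 0 < x ->
  (y `^ a) @[y --> x^'+] --> x `^ a.
Proof. by move=> x0; apply: cvg_at_right_filter; exact: powR_continuous_at. Qed.

Lemma powR_decreasing (R : realType) (a x y : R) : 0 <= a -> 0 < x -> x <= y ->
  y `^ (- a) <= x `^ (- a).
Proof.
move=> a0 x0 xy; rewrite !powRN lef_pV2 ?posrE ?powR_gt0// ?(lt_le_trans x0)//.
by rewrite ge0_ler_powR// nnegrE ltW// (lt_le_trans x0).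
Qed.

Lemma powR_cvgNy (R : realType) (a : R) : 0 < a -> (y `^ (- a)) @[y --> +oo] --> (0 : R).
Proof.
move=> a0; apply/cvgrPdist_lt => e e0.
near=> y; have y0 : 0 < y by near: y; exact: nbhs_pinfty_gt.
have ey : e^-1 `^ a^-1 < y by near: y; exact: nbhs_pinfty_gt.
rewrite sub0r normrN gtr0_norm ?powR_gt0// powRN invf_plt ?posrE ?powR_gt0//.
have -> : e^-1 = (e^-1 `^ a^-1) `^ a.
  by rewrite -powRrM mulVf ?gt_eqF// powRr1// invr_ge0 ltW.
by rewrite gt0_ltr_powR// nnegrE ?powR_ge0 ?ltW.
Unshelve. all: by end_near. Qed.

(** * Pareto classes *)

Lemma cvg_maxr (R : realType) (T : Type) (H : set_system T) (f g : T -> R) (a b : R) :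
    Filter H -> f x @[x --> H] --> a -> g x @[x --> H] --> b ->
  Num.max (f x) (g x) @[x --> H] --> Num.max a b.
Proof.
move=> FH fa gb; under eq_fun do rewrite maxr_absE; rewrite maxr_absE.
apply: cvgMl; apply: cvgD; first exact: cvgD.
by apply: cvg_norm; exact: cvgB.
Qed.

Section pareto.
Context (R : realType) (tau C C' : R).
Context (tau_gt0 : 0 < tau) (C_gt0 : 0 < C) (C'_gt0 : 0 < C').

Lemma powR_cancel (x : R) : 0 < x -> x `^ tau * x `^ (- tau) = 1.
Proof. by move=> x0; rewrite powRN divff// gt_eqF// powR_gt0. Qed.

Lemma powR_band (x b : R) : 0 < x ->
  x `^ (- (tau * (b + 1))) = x `^ (- (tau * b)) * x `^ (- tau).
Proof.
move=> x0; have -> : - (tau * (b + 1)) = - (tau * b) + - tau by ring.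
by rewrite powRD//; apply/implyP => _; rewrite gt_eqF.
Qed.

Lemma exact_paretoE (x : R) : 0 < x ->
  exact_pareto tau C x = Num.max 0 (1 - C * x `^ (- tau)).
Proof.
move=> x0; have x't := powR_gt0 (- tau) x0.
rewrite /exact_pareto.
have -> : (C `^ tau^-1 <= x) = (0 <= 1 - C * x `^ (- tau)).
  rewrite subr_ge0 powRN ler_pdivrMr ?powR_gt0// mul1r.
  have {2}-> : C = (C `^ tau^-1) `^ tau.
    by rewrite -powRrM mulVf ?gt_eqF// powRr1// ltW.
  apply/idP/idP => [Cx|]; first by rewrite ge0_ler_powR ?nnegrE ?powR_ge0 ?(ltW tau_gt0) ?(ltW x0).
  apply: contraTT; rewrite -!ltNge => xC.
  by rewrite gt0_ltr_powR ?nnegrE ?powR_ge0 ?(ltW x0).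
by rewrite /Num.max; case: ltgtP => // <-.
Qed.

Lemma exact_pareto_le0 (x : R) : x <= 0 -> exact_pareto tau C x = 0.
Proof.
by move=> x0; rewrite /exact_pareto leNgt (le_lt_trans x0)// powR_gt0.
Qed.

Lemma exact_pareto_nonneg_df : nonneg_df (exact_pareto tau C).
Proof.
apply: nonneg_dfI.
- move=> x y xy; have [x0|x0] := leP x 0.
    rewrite exact_pareto_le0//; have [y0|y0] := leP y 0; first by rewrite exact_pareto_le0.
    by rewrite exact_paretoE// le_max lexx.
  rewrite !exact_paretoE ?(lt_le_trans x0)// ge_max !le_max lexx/=.
  by apply/orP; right; rewrite lerB// ler_pM2l// powR_decreasing// ltW.
- move=> x; have [x0|x0] := leP (C `^ tau^-1) x.
    have x_gt0 : 0 < x by rewrite (lt_le_trans _ x0)// powR_gt0.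
    rewrite {2}/exact_pareto x0.
    apply: (@cvg_trans _ ((fun y => 1 - C * y `^ (- tau)) @ x^'+)).
      apply: near_eq_cvg; near=> y; rewrite /exact_pareto (le_trans x0)//.
    by apply: cvgB; [exact: cvg_cst|apply: cvgMr; exact: powR_cvg_right].
  rewrite {2}/exact_pareto leNgt x0/=.
  apply: (@cvg_trans _ ((fun=> 0 : R) @ x^'+)); last exact: cvg_cst.
  apply: near_eq_cvg; near=> y; rewrite /exact_pareto leNgt.
  suff -> : y < C `^ tau^-1 by [].
  by near: y; exact: nbhs_right_lt.
- by move=> x /ltW; exact: exact_pareto_le0.
- have lim1 : (1 - C * y `^ (- tau)) @[y --> +oo] --> 1 - C * 0.
    by apply: cvgB; [exact: cvg_cst|apply: cvgMr; exact: powR_cvgNy].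
  rewrite mulr0 subr0 in lim1; apply: cvg_trans lim1.
  apply: near_eq_cvg; near=> y; rewrite /exact_pareto.
  suff -> : C `^ tau^-1 <= y by [].
  by near: y; exact: nbhs_pinfty_ge.
Unshelve. all: by end_near. Qed.

Lemma exact_pareto_class (b : R) : pareto_class tau b%:E C C' (exact_pareto tau C).
Proof.
split; first exact: exact_pareto_nonneg_df.
move=> x x0; rewrite exact_paretoE// lt_max ltxx/= => /andP[+ _].
move=> /ltW/max_r ->; rewrite (_ : _ - _ = 0); last by ring.
by rewrite normr0 mulr_ge0// ?ltW// powR_gt0.
Qed.

(** For x >= 1 the band has half-width at most C' x^(-tau); for x < 1 the tail is at most 1, which
    is below x^(-tau). This is the origin of the summand 1 in the constant. *)
Lemma pareto_class_tail_ub (b : R) (F : R -> R) (x : R) : 0 < b -> pareto_class tau b%:E C C' F ->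
  0 < x -> 0 < F x -> 1 - F x <= (1 + C + C') * x `^ (- tau).
Proof.
move=> b0 [[P _ PF] band] x0 Fx0.
have x't := powR_gt0 (- tau) x0.
have Fx1 := df_le1 PF x; have FP := df_ge0 PF x.
have [x1|x1] := leP 1 x.
  have := band x x0; rewrite Fx0 Fx1 => /(_ isT); rewrite powR_band//.
  have : x `^ (- (tau * b)) <= 1.
    rewrite -[leRHS](powRr0 x) ler_powR// oppr_le0 mulr_ge0// ltW//.
  move=> xb1; rewrite ler_norml => /andP[_].
  have : C' * (x `^ (- (tau * b)) * x `^ (- tau)) <= C' * x `^ (- tau).
    by rewrite ler_pM2l// ler_piMl// ltW.
  have -> : (1 + C + C') * x `^ (- tau) = x `^ (- tau) + C * x `^ (- tau) + C' * x `^ (- tau) by ring.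
  lra.
have : 1 <= x `^ (- tau).
  by rewrite -(powRr0 x) ger_powR ?x0 ?ltW// oppr_lt0.
have : 0 <= (C + C') * x `^ (- tau) by rewrite mulr_ge0// ?addr_ge0// ltW.
have -> : (1 + C + C') * x `^ (- tau) = x `^ (- tau) + (C + C') * x `^ (- tau) by ring.
lra.
Qed.

(** Far enough out, the half-width of the band is at most half of the Pareto tail. Where F vanishes,
    the tail is 1, and the last condition puts the Pareto tail below it. *)
Lemma pareto_class_tail_lb (b : R) (F : R -> R) (x : R) : pareto_class tau b%:E C C' F ->
    0 < x -> C' * x `^ (- (tau * b)) <= C / 2 -> C * x `^ (- tau) <= 1 ->
  C / 2 * x `^ (- tau) <= 1 - F x.
Proof.
move=> [[P _ PF] band] x0 xb x1.
have x't := powR_gt0 (- tau) x0.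
have Fx1 := df_le1 PF x; have := df_ge0 PF x.
rewrite le_eqVlt => /predU1P[<-|Fx0].
  by rewrite subr0 (le_trans _ x1)// ler_pM2r// ler_pdivrMr// ler_peMr ?ltW// ltr1n.
have := band x x0; rewrite Fx0 Fx1 => /(_ isT); rewrite powR_band//.
rewrite ler_norml => /andP[+ _].
have : C' * (x `^ (- (tau * b)) * x `^ (- tau)) <= C / 2 * x `^ (- tau).
  by rewrite mulrA ler_pM2r.
lra.
Qed.

(* Lowering F by r x^(-tau) keeps it nondecreasing and moves it below the upper
   boundary of the band, while the lower boundary is itself nondecreasing. *)
Lemma pareto_class_projection (b : R) (F : R -> R) (r : R) : 0 < b -> 0 < r -> nonneg_df F ->
    (forall x : R, 0 < x -> r * x `^ (- tau) <= F x ->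
      `|1 - F x - C * x `^ (- tau)| <= C' * x `^ (- (tau * (b + 1))) + r * x `^ (- tau)) ->
  exists2 G, pareto_class tau b%:E C C' G &
    forall x : R, 0 < x -> `|F x - G x| <= r * x `^ (- tau).
Proof.
move=> b0 r0 [P P0 PF] Fband.
have tb0 : 0 < tau * (b + 1) by rewrite mulr_gt0// addr_gt0.
pose L (x : R) : R := 1 - C * x `^ (- tau) - C' * x `^ (- (tau * (b + 1))).
pose eta (x : R) : R := r * x `^ (- tau).
have eta0 (x : R) : 0 < x -> 0 < eta x by move=> x0; rewrite mulr_gt0// powR_gt0.
have eta_nincr (x y : R) : 0 < x -> x <= y -> eta y <= eta x.
  by move=> x0 xy; rewrite ler_pM2l// powR_decreasing// ltW.
have L_ndecr (x y : R) : 0 < x -> x <= y -> L x <= L y.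
  by move=> x0 xy; rewrite lerB// ?lerB// ler_pM2l// powR_decreasing// ltW.
have Fnd := df_nondecreasing PF.
(* Where F < [eta] the value 0 is already within [eta] of F and escapes the band condition. The set
   where [eta] <= F is closed to the right, [eta] being nonincreasing and F nondecreasing, so
   cutting to 0 outside it preserves monotonicity. *)
pose G (x : R) : R := if (0 < x) && (eta x <= F x) then Num.max (L x) (F x - eta x) else 0.
have Gge0 (x : R) : 0 <= G x.
  by rewrite /G; case: ifP => // /andP[_ Fx]; rewrite le_max (subr_ge0 (eta x)) Fx orbT.
exists G; last first.
  move=> x x0; rewrite /G x0/=; case: ifPn => [Fx|]; last first.
    rewrite -ltNge subr0 ger0_norm; last exact: (df_ge0 PF).
    exact: ltW.
  have := Fband x x0 Fx; rewrite ler_norml => /andP[_ Hx].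
  have ex := eta0 x x0.
  by rewrite /Num.max; case: ifPn => Hm; rewrite ler_norml; apply/andP; split;
    move: ex Hx Hm; rewrite /L /eta -?leNgt; lra.
split; last first.
  move=> x x0; rewrite /G x0/=; case: ifPn => [Fx _|_]; last by rewrite ltxx.
  have := Fband x x0 Fx; rewrite ler_norml => /andP[Hx _].
  have xb := powR_gt0 (- (tau * (b + 1))) x0.
  have C'x : 0 < C' * x `^ (- (tau * (b + 1))) by rewrite mulr_gt0.
  by rewrite /Num.max; case: ifPn => Hm; rewrite ler_norml; apply/andP; split;
    move: C'x Hx Hm; rewrite /L /eta -?leNgt; lra.
apply: nonneg_dfI.
- move=> x y xy; rewrite {1}/G; case: ifPn => [/andP[x0 Fx]|_]; last exact: Gge0.
  have y0 := lt_le_trans x0 xy; have eyx := eta_nincr x y x0 xy.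
  have Fxy := Fnd _ _ xy; have Lxy := L_ndecr x y x0 xy.
  rewrite /G y0 (le_trans eyx (le_trans Fx Fxy))/= ge_max !le_max Lxy/=.
  by apply/orP; right; rewrite lerB.
- move=> x; have [x0|x0] := leP x 0.
    rewrite {2}/G ltNge x0/=.
    apply: (@cvg_trans _ ((fun=> 0 : R) @ x^'+)); last exact: cvg_cst.
    apply: near_eq_cvg; near=> y; rewrite /G; case: ifPn => // /andP[y0 Fy].
    (* At points y > 0 close to 0, [eta] exceeds every value of F, so the cut makes [G] vanish
       there. *)
    have : 2 <= eta y.
      rewrite /eta -ler_pdivrMl// powRN invf_pge ?posrE ?powR_gt0 ?mulr_gt0 ?invr_gt0//.
      have -> : (r^-1 * 2)^-1 = ((r^-1 * 2)^-1 `^ tau^-1) `^ tau.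
        by rewrite -powRrM mulVf ?gt_eqF// powRr1// invr_ge0 mulr_ge0 ?invr_ge0 ?ltW.
      rewrite ge0_ler_powR ?nnegrE ?powR_ge0 ?(ltW tau_gt0) ?(ltW y0)//.
      apply: ltW; near: y; apply: nbhs_right_lt.
      by rewrite (le_lt_trans x0)// powR_gt0// invr_gt0 mulr_gt0// invr_gt0.
    by have := df_le1 PF y; move: Fy; lra.
  have ecvg : eta y @[y --> x^'+] --> eta x.
    by apply: cvgMr; exact: powR_cvg_right.
  have Lcvg : L y @[y --> x^'+] --> L x.
    apply: cvgB; last by apply: cvgMr; exact: powR_cvg_right.
    by apply: cvgB; [exact: cvg_cst|apply: cvgMr; exact: powR_cvg_right].
  have Fcvg : F y @[y --> x^'+] --> F x by exact: (df_right_continuous PF).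
  rewrite {2}/G x0/=; case: ifPn => [Fx|].
    apply: (@cvg_trans _ ((fun y => Num.max (L y) (F y - eta y)) @ x^'+)).
      apply: near_eq_cvg; near=> y; have xy : x < y by near: y; exact: nbhs_right_gt.
      rewrite /G (lt_trans x0 xy) (le_trans (eta_nincr x y x0 (ltW xy)))//.
      by rewrite (le_trans Fx)// Fnd// ltW.
    by apply: cvg_maxr => //; exact: cvgB.
  rewrite -ltNge => Fx.
  apply: (@cvg_trans _ ((fun=> 0 : R) @ x^'+)); last exact: cvg_cst.
  apply: near_eq_cvg; near=> y; rewrite /G.
  suff : F y < eta y by rewrite ltNge => /negbTE ->; rewrite andbF.
  rewrite -subr_gt0; near: y; apply: (cvgr_gt (eta x - F x)); last by rewrite subr_gt0.
  exact: cvgB.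
- by move=> x x0; rewrite /G ltNge (ltW x0).
- have ecvg : eta y @[y --> +oo] --> (0 : R).
    have lim0 : eta y @[y --> +oo] --> r * 0 by apply: cvgMr; exact: powR_cvgNy.
    by rewrite mulr0 in lim0.
  have Lcvg : L y @[y --> +oo] --> (1 : R).
    have lim1 : L y @[y --> +oo] --> 1 - C * 0 - C' * 0.
      apply: cvgB; last by apply: cvgMr; exact: powR_cvgNy.
      by apply: cvgB; [exact: cvg_cst|apply: cvgMr; exact: powR_cvgNy].
    by rewrite !mulr0 !subr0 in lim1.
  have Fcvg := df_cvgy PF.
  have FEcvg : (F y - eta y) @[y --> +oo] --> (1 : R).
    have lim1 : (F y - eta y) @[y --> +oo] --> (1 - 0 : R) by exact: cvgB.
    by rewrite subr0 in lim1.
  apply: (@cvg_trans _ ((fun y => Num.max (L y) (F y - eta y)) @ +oo)).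
    apply: near_eq_cvg; near=> y; have y0 : 0 < y by near: y; exact: nbhs_pinfty_gt.
    rewrite /G y0/= -subr_ge0 ltW//; near: y; apply: (cvgr_gt 1) => //.
  have lim1 : Num.max (L y) (F y - eta y) @[y --> +oo] --> Num.max (1 : R) 1.
    exact: cvg_maxr.
  by rewrite maxxx in lim1.
Unshelve. all: by end_near. Qed.

End pareto.

Lemma right_rat_seq (R : realType) (x z : R) (Q : R -> Prop) : x < z ->
  (\forall y \near x^'+, Q y) -> exists k, [/\ x < rat_seq R k, rat_seq R k < z & Q (rat_seq R k)].
Proof.
move=> xz [e /= e0 He].
have [|k xk] := @rat_seqP R x (Num.min z (x + e)); first by rewrite lt_min xz ltrDl.
rewrite lt_min => /andP[kz kxe]; exists k; split => //; apply: He => //=.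
by rewrite ltr0_norm ?subr_lt0// opprB ltrBlDl.
Qed.

(** * Separated alternatives and the test *)

Section alternatives.
Context (R : realType) (tau C C' : R).
Context (tau_gt0 : 0 < tau) (C_gt0 : 0 < C) (C'_gt0 : 0 < C').

Lemma wdist_le (F G : R -> R) (r : R) : nonneg_df F -> 0 <= r ->
    (forall x : R, 0 < x -> 0 < F x -> `|F x - G x| <= r * x `^ (- tau)) ->
  (wdist tau F G <= r%:E)%E.
Proof.
move=> dfF r0 FG; apply: ge_ereal_sup => _ [x /= /andP[Fx0 Fx1] <-]; rewrite lee_fin.
have [x0|x0|->] := ltgtP x 0.
- by move: Fx0; rewrite nonneg_df_lt0 ?ltxx.
- rewrite -mulrBr normrM (gtr0_norm (powR_gt0 _ x0)).
  rewrite (_ : _ - _ - _ = - (F x - G x)); last by ring.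
  rewrite normrN -(mulr1 r) -(powR_cancel tau x0) mulrCA.
  by rewrite ler_pM2l ?powR_gt0// FG.
- by rewrite powR0 ?gt_eqF// !mul0r subrr normr0.
Qed.

Lemma separated_wdist (beta1 : R) (beta0 : \bar R) (rho r : R) (F G : R -> R) :
    separated_class tau beta1 beta0 C C' rho F ->
    pareto_class tau beta0 C C' G -> 0 <= r ->
    (forall x : R, 0 < x -> 0 < F x -> `|F x - G x| <= r * x `^ (- tau)) ->
  rho <= r.
Proof.
move=> [[dfF _] sepF] HG r0 FG; rewrite -lee_fin; apply: (le_trans sepF).
apply: le_trans (wdist_le dfF r0 FG).
by apply: ereal_inf_lbound; exists G.
Qed.

Lemma band_far (beta1 rho X : R) (F : R -> R) : 0 < beta1 -> 0 < X ->
    C' * X `^ (- (tau * beta1)) <= rho / 2 -> pareto_class tau beta1%:E C C' F ->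
  forall x : R, X <= x -> 0 < F x ->
    `|1 - F x - C * x `^ (- tau)| <= rho / 2 * x `^ (- tau).
Proof.
move=> b0 X0 Xrho [[P _ PF] band] x Xx Fx.
have x0 := lt_le_trans X0 Xx.
apply: (le_trans (band x x0 _)); first by rewrite Fx (df_le1 PF).
rewrite powR_band// mulrA ler_pM2r ?powR_gt0//.
apply: le_trans Xrho; rewrite ler_pM2l// powR_decreasing//.
by rewrite mulr_ge0// ltW.
Qed.

(** Otherwise F stays within rho / 2 x^(-tau) of the band wherever the projection lemma asks for it,
    by [band_far] beyond X and by assumption below X. The projection then gives a member of S(b0) at
    distance at most rho / 2 < rho. *)
Lemma separated_band (beta1 b0 rho X : R) (F : R -> R) :
    0 < beta1 -> 0 < b0 -> 0 < rho -> 0 < X ->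
    C' * X `^ (- (tau * beta1)) <= rho / 2 ->
    separated_class tau beta1 b0%:E C C' rho F ->
  exists x : R, [/\ 0 < x, x < X, rho / 2 * x `^ (- tau) <= F x &
    C' * x `^ (- (tau * (b0 + 1))) + rho / 2 * x `^ (- tau) <
      `|1 - F x - C * x `^ (- tau)|].
Proof.
move=> b1_gt0 b0_gt0 rho0 X0 Xrho sepF; have [HF _] := sepF.
apply: contrapT => nex.
have rho2 : 0 < rho / 2 by rewrite divr_gt0.
have [//|x x0 Fx|G HG FG] :=
    @pareto_class_projection R tau C C' tau_gt0 C_gt0 C'_gt0 b0 F (rho / 2) b0_gt0 rho2.
- by case: HF.
- have Fx0 : 0 < F x by apply: lt_le_trans Fx; rewrite mulr_gt0// powR_gt0.
  have [Xx|xX] := leP X x.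
    apply: (le_trans (band_far b1_gt0 X0 Xrho HF Xx Fx0)).
    by rewrite lerDr mulr_ge0// ?ltW// powR_gt0.
  by rewrite leNgt; apply/negP => H; apply: nex; exists x.
- have := separated_wdist sepF HG (ltW rho2) (fun x x0 _ => FG x x0).
  by lra.
Qed.

(** For infinite beta0 the only candidate neighbour is the Pareto law, so the projection is replaced
    by a direct comparison; C X^(-tau) <= 1 ensures that beyond X its tail is exactly C x^(-tau). *)
Lemma separated_exact (beta1 rho X : R) (F : R -> R) :
    0 < beta1 -> 0 < rho -> 0 < X -> C * X `^ (- tau) <= 1 ->
    C' * X `^ (- (tau * beta1)) <= rho / 2 ->
    separated_class tau beta1 +oo C C' rho F ->
  exists x : R, [/\ 0 < x, x < X, 0 < F x &
    rho / 2 * x `^ (- tau) < `|F x - exact_pareto tau C x|].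
Proof.
move=> b1_gt0 rho0 X0 CX Xrho sepF; have [HF _] := sepF.
apply: contrapT => nex.
have rho2 : 0 < rho / 2 by rewrite divr_gt0.
suff : rho <= rho / 2 by lra.
apply: (separated_wdist sepF (G := exact_pareto tau C)) => //; first exact: ltW.
move=> x x0 Fx0; have [Xx|xX] := leP X x; last first.
  by rewrite leNgt; apply/negP => H; apply: nex; exists x.
rewrite exact_paretoE// max_r; last first.
  rewrite subr_ge0 (le_trans _ CX)// ler_pM2l// powR_decreasing//; exact: ltW.
rewrite -normrN (_ : - _ = 1 - F x - C * x `^ (- tau)); last by ring.
exact: (band_far b1_gt0 X0 Xrho HF Xx Fx0).
Qed.

(* The relative error eps of the empirical tail on (0, b] turns into the absolute
   error rho / 8 * x^(-tau), since tails in the class are at most (1 + C + C') x^(-tau). *)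
Lemma pareto_test (beta1 rho X b : R) (beta0 : \bar R) n :
    0 < beta1 -> (beta1%:E < beta0)%E -> 0 < rho -> 0 < X -> X < b -> (0 < n)%N ->
    C * X `^ (- tau) <= 1 -> C' * X `^ (- (tau * beta1)) <= rho / 2 ->
  let eps := rho / (8 * (1 + C + C')) in
  exists Psi : test n, forall P F, has_df P F -> F b < 1 ->
    (pareto_class tau beta0 C C' F ->
      ('E_(iid_law P n)[(fun X => (Psi X)%:R)%R]
        <= (F b / (n%:R * eps ^+ 2 * (1 - F b)))%:E)%E) /\
    (separated_class tau beta1 beta0 C C' rho F ->
      ('E_(iid_law P n)[(fun X => 1 - (Psi X)%:R)%R]
        <= (F b / (n%:R * eps ^+ 2 * (1 - F b)))%:E)%E).
Proof.
move=> b1_gt0 b10 rho0 X0 Xb n0 CX C'X eps.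
have K0 : 0 < 1 + C + C' by rewrite !addr_gt0.
have eps0 : 0 < eps by rewrite divr_gt0// mulr_gt0.
have epsK y u t : y <= (1 + C + C') * u -> `|t - y| <= eps * y -> `|t - y| <= rho / 8 * u.
  move=> yu ty; apply: (le_trans ty); apply: (@le_trans _ _ (eps * ((1 + C + C') * u))).
    by rewrite ler_pM2l.
  by rewrite le_eqVlt; apply/orP; left; apply/eqP; rewrite /eps; field; rewrite gt_eqF.
case: beta0 b10 => [b0|_|//].
  rewrite lte_fin => b10; have b0_gt0 := lt_trans b1_gt0 b10.
  (* The threshold rho / 4 lies between the noise rho / 8 under the null and the remaining signal
     rho / 2 - rho / 8 under the alternative. The first conjunct silences points where F vanishes:
     there t = 1, and leaving the band proves nothing. *)
  pose V (q t : R) := (rho / 4 * q `^ (- tau) <= 1 - t) &&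
    (C' * q `^ (- (tau * (b0 + 1))) + rho / 4 * q `^ (- tau) < `|t - C * q `^ (- tau)|).
  have [Psi PsiE] := tail_region_test n b V; exists Psi => P F PF Fb1; split=> HF.
    rewrite (PsiE P).1; apply: tail_region_null => // q t /andP[q0 qb] tF tq.
    have q't := powR_gt0 (- tau) q0.
    have := df_ge0 PF q; rewrite le_eqVlt => /predU1P[Fq0|Fq0].
      by rewrite /V tF// subrr leNgt mulr_gt0// divr_gt0.
    have := epsK _ _ _ (pareto_class_tail_ub tau_gt0 C_gt0 C'_gt0 b0_gt0 HF q0 Fq0) tq.
    have := HF.2 q q0; rewrite Fq0 (df_le1 PF) => /(_ isT).
    rewrite /V negb_and -!leNgt => B1 B2; apply/orP; right.
    have -> : t - C * q `^ (- tau) = (1 - F q - C * q `^ (- tau)) + (t - (1 - F q)) by ring.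
    apply: (le_trans (ler_normD _ _)); apply: lerD => //.
    by apply: (le_trans B2); rewrite ler_pM2r//; lra.
  have [x [x0 xX Fx viol]] := separated_band b1_gt0 b0_gt0 rho0 X0 C'X HF.
  (* The violation is strict and F is right continuous, so it persists at some rational to the right
     of x, still below b because x < X < b. *)
  have [||k [xk kb viol']] := @right_rat_seq R x b (fun q =>
      C' * q `^ (- (tau * (b0 + 1))) + rho / 2 * q `^ (- tau) <
      `|1 - F q - C * q `^ (- tau)|).
  - exact: lt_trans Xb.
  - pose g q := `|1 - F q - C * q `^ (- tau)| -
      (C' * q `^ (- (tau * (b0 + 1))) + rho / 2 * q `^ (- tau)).
    have gcvg : g q @[q --> x^'+] --> g x.
      apply: cvgB.
        apply: cvg_norm; apply: cvgB; last by apply: cvgMr; exact: powR_cvg_right.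
        by apply: cvgB; [exact: cvg_cst|exact: (df_right_continuous PF)].
      by apply: cvgD; apply: cvgMr; exact: powR_cvg_right.
    have : \forall q \near x^'+, 0 < g q by apply: (cvgr_gt (g x)) => //; rewrite subr_gt0.
    by apply: filterS => q; rewrite /g subr_gt0.
  set q := rat_seq R k in xk kb viol'.
  have q0 := lt_trans x0 xk.
  have q't := powR_gt0 (- tau) q0.
  have Fq : rho / 2 * q `^ (- tau) <= F q.
    apply: (le_trans _ (df_nondecreasing PF (ltW xk))); apply: le_trans Fx.
    by rewrite ler_pM2l ?divr_gt0// powR_decreasing// ltW.
  have Fq0 : 0 < F q by apply: lt_le_trans Fq; rewrite mulr_gt0// divr_gt0.
  rewrite (PsiE P).2; apply: (tail_region_alt (k := k)) => //; rewrite -/q.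
    by rewrite q0 ltW.
  move=> t tq.
  have := epsK _ _ _ (pareto_class_tail_ub tau_gt0 C_gt0 C'_gt0 b1_gt0 HF.1 q0 Fq0) tq.
  move=> tq'; have := tq'; rewrite ler_norml => /andP[t1 t2].
  have rq : 0 < rho * q `^ (- tau) by rewrite mulr_gt0.
  apply/andP; split; first by lra.
  have : `|1 - F q - C * q `^ (- tau)| <= `|t - C * q `^ (- tau)| + `|t - (1 - F q)|.
    have -> : 1 - F q - C * q `^ (- tau) = (t - C * q `^ (- tau)) - (t - (1 - F q)) by ring.
    exact: ler_normB.
  by lra.
(* Here a point with F q = 0 gives t = 1 and hence deviation 0 from the Pareto law under the null,
   so the deviation alone decides. *)
pose V (q t : R) := rho / 4 * q `^ (- tau) < `|t - (1 - exact_pareto tau C q)|.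
have [Psi PsiE] := tail_region_test n b V; exists Psi => P F PF Fb1; split=> HF.
  rewrite (PsiE P).1; apply: tail_region_null => // q t /andP[q0 qb] tF tq.
  have q't := powR_gt0 (- tau) q0.
  rewrite /= in HF; rewrite /V -HF -leNgt.
  have := df_ge0 PF q; rewrite le_eqVlt => /predU1P[Fq0|Fq0].
    by rewrite tF// -Fq0 subr0 subrr normr0 mulr_ge0 ?ltW// divr_gt0.
  have HF1 : pareto_class tau beta1%:E C C' F.
    by rewrite HF; exact: exact_pareto_class.
  apply: (le_trans (epsK _ _ _ (pareto_class_tail_ub tau_gt0 C_gt0 C'_gt0 b1_gt0 HF1 q0 Fq0) tq)).
  by rewrite ler_pM2r//; lra.
have [x [x0 xX Fx0 viol]] := separated_exact b1_gt0 rho0 X0 CX C'X HF.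
have [PE _ PEF] := exact_pareto_nonneg_df tau_gt0 C_gt0.
have [||k [xk kb viol']] := @right_rat_seq R x b (fun q =>
    rho / 2 * q `^ (- tau) < `|F q - exact_pareto tau C q|).
- exact: lt_trans Xb.
- pose g q := `|F q - exact_pareto tau C q| - rho / 2 * q `^ (- tau).
  have gcvg : g q @[q --> x^'+] --> g x.
    apply: cvgB; last by apply: cvgMr; exact: powR_cvg_right.
    by apply: cvg_norm; apply: cvgB; apply: df_right_continuous; [exact: PF|exact: PEF].
  have : \forall q \near x^'+, 0 < g q by apply: (cvgr_gt (g x)) => //; rewrite subr_gt0.
  by apply: filterS => q; rewrite /g subr_gt0.
set q := rat_seq R k in xk kb viol'.
have q0 := lt_trans x0 xk.
have q't := powR_gt0 (- tau) q0.
have Fq0 : 0 < F q by rewrite (lt_le_trans Fx0)// (df_nondecreasing PF)// ltW.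
rewrite (PsiE P).2; apply: (tail_region_alt (k := k)) => //; rewrite -/q.
  by rewrite q0 ltW.
move=> t tq.
have := epsK _ _ _ (pareto_class_tail_ub tau_gt0 C_gt0 C'_gt0 b1_gt0 HF.1 q0 Fq0) tq.
have : `|F q - exact_pareto tau C q| <= `|t - (1 - exact_pareto tau C q)| + `|t - (1 - F q)|.
  have -> : F q - exact_pareto tau C q = (t - (1 - F q)) - (t - (1 - exact_pareto tau C q)) by ring.
  by rewrite [leRHS]addrC; exact: ler_normB.
have rq : 0 < rho * q `^ (- tau) by rewrite mulr_gt0.
by rewrite /V; lra.
Qed.

End alternatives.

(** * Existence of a consistent test *)

Lemma cvg_natr_powR (R : realType) (a : R) : 0 < a ->
  (n%:R `^ a : R) @[n --> \oo] --> +oo.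
Proof.
move=> a0; apply/cvgryPge => A; near=> n.
have nA : Num.max A 0 `^ a^-1 <= n%:R by near: n; exact: nbhs_infty_ger.
apply: (@le_trans _ _ (Num.max A 0)); first by rewrite le_max lexx.
have -> : Num.max A 0 = (Num.max A 0 `^ a^-1) `^ a.
  by rewrite -powRrM mulVf ?gt_eqF// powRr1// le_max lexx orbT.
by rewrite ge0_ler_powR ?nnegrE ?powR_ge0 ?(ltW a0).
Unshelve. all: by end_near. Qed.

Section upper_bound.
Context (R : realType) (alpha tau C C' beta1 : R) (beta0 : \bar R).
Context (alpha_gt0 : 0 < alpha) (tau_gt0 : 0 < tau) (C_gt0 : 0 < C)
  (C'_gt0 : 0 < C') (beta1_gt0 : 0 < beta1) (beta10 : (beta1%:E < beta0)%E).

Let nu := beta1 / (2 * beta1 + 1).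
Let K := 1 + C + C'.
(** With eps = rho_n / (8 K) and 1 - F b >= C / (4 T), where T = n^(1 / (2 beta1 + 1)), the maximal
    inequality gives (16 K)^2 / (C M^2). This is at most alpha / 2 as soon as M^2 >= [z], which
    follows from M >= [z] and M >= 1. The summand 2 C' of [M] makes the bias beyond X at most rho_n
    / 2. *)
Let z := 2 * (16 * K) ^+ 2 / (alpha * C).
Let M := 2 * C' + 1 + z.
Let rho (n : nat) : R := M * n%:R `^ (- nu).

Let den_gt0 : 0 < 2 * beta1 + 1.
Proof. by rewrite addr_gt0// mulr_gt0. Qed.

Let K_gt0 : 0 < K. Proof. by rewrite !addr_gt0. Qed.

Let z_ge0 : 0 <= z.
Proof. by rewrite divr_ge0 ?mulr_ge0 ?sqr_ge0 ?ltW. Qed.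

Let M_ge1 : 1 <= M.
Proof. by move: C'_gt0 z_ge0; rewrite /M; lra. Qed.

Let M_gt0 : 0 < M.
Proof. exact: lt_le_trans M_ge1. Qed.

Let M_large : 2 * (16 * K) ^+ 2 <= alpha * C * M ^+ 2.
Proof.
rewrite [leRHS]mulrC -ler_pdivrMr ?mulr_gt0// -/z.
have zM : z <= M by move: C'_gt0; rewrite /M; lra.
by apply: (le_trans zM); rewrite expr2 ler_peMl// ltW.
Qed.

(** Parametrised by y = x^tau. The threshold on y is chosen before F, which gives the uniformity
    over the class that the supremum of the risks requires. *)
Let pareto_tail_gt (b : R) : 0 < b -> \forall y \near pinfty_nbhs R,
  forall F, pareto_class tau b%:E C C' F -> C / 2 * y^-1 <= 1 - F (y `^ tau^-1).
Proof.
move=> b0.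
have lim0 : C' * y `^ (- b) @[y --> +oo] --> C' * 0 by apply: cvgMr; exact: powR_cvgNy.
have C2 : C' * 0 < C / 2 by rewrite mulr0 divr_gt0.
have small := cvgr_le _ lim0 _ C2.
near=> y.
have y0 : 0 < y by near: y; exact: nbhs_pinfty_gt.
have yC : C <= y by near: y; apply: nbhs_pinfty_ge; exact: num_real.
have yb : C' * y `^ (- b) <= C / 2 by near: y; exact: small.
have yt : (y `^ tau^-1) `^ (- tau) = y^-1.
  by rewrite -powRrM mulrN mulVf ?gt_eqF// powR_inv1// ltW.
have ytb : (y `^ tau^-1) `^ (- (tau * b)) = y `^ (- b).
  by rewrite -powRrM; congr (_ `^ _); field; rewrite gt_eqF.
move=> F HF.
have := pareto_class_tail_lb C_gt0 HF (powR_gt0 tau^-1 y0).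
rewrite yt ytb; apply => //.
by rewrite ler_pdivrMr// mul1r.
Unshelve. all: by end_near. Qed.

Let pareto_tail_gt0 : \forall y \near pinfty_nbhs R,
  forall F, pareto_class tau beta0 C C' F -> C / 2 * y^-1 <= 1 - F (y `^ tau^-1).
Proof.
case: beta0 beta10 => [b0||//].
  by rewrite lte_fin => b10; apply: pareto_tail_gt; exact: lt_trans b10.
move=> _; have := pareto_tail_gt beta1_gt0; apply: filterS => y Hy F /= ->.
by apply: Hy; exact: exact_pareto_class.
Qed.

Let good_test (n : nat) (Psi : test n) :=
  (sup_risk (pareto_class tau beta0 C C') (fun X => (Psi X)%:R)
   + sup_risk (separated_class tau beta1 beta0 C C' (rho n)) (fun X => 1 - (Psi X)%:R)%R
   <= alpha%:E)%E.

Let good_test_exists : \forall n \near \oo, exists Psi : test n, good_test Psi.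
Proof.
(* [T n] is X^tau and 2 [T n] is b^tau; the factor 2 leaves room between X and b for the passage to
   a rational. *)
pose T (n : nat) : R := n%:R `^ (2 * beta1 + 1)^-1.
have T2cvg : 2 * T n @[n --> \oo] --> +oo.
  have Tcvg : T n @[n --> \oo] --> +oo by apply: cvg_natr_powR; rewrite invr_gt0.
  apply/cvgryPge => A; near=> n; rewrite mulrC -ler_pdivrMr//.
  by near: n; exact: ((cvgryPge _).1 Tcvg).
have E1 := T2cvg _ (pareto_tail_gt beta1_gt0).
have E0 := T2cvg _ pareto_tail_gt0.
have EC : \forall n \near \oo, 2 * C <= 2 * T n by exact: ((cvgryPge _).1 T2cvg).
near=> n.
have tail1 (G : R -> R) : pareto_class tau beta1%:E C C' G ->
    C / 2 * (2 * T n)^-1 <= 1 - G ((2 * T n) `^ tau^-1).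
  by move: G; near: n; exact: E1.
have tail0 (G : R -> R) : pareto_class tau beta0 C C' G ->
    C / 2 * (2 * T n)^-1 <= 1 - G ((2 * T n) `^ tau^-1).
  by move: G; near: n; exact: E0.
have n0 : (0 < n)%N by near: n; exact: nbhs_infty_gt.
have n0R : 0 < n%:R :> R by rewrite ltr0n.
have T0 : 0 < T n by exact: powR_gt0.
have CT : C <= T n.
  have : 2 * C <= 2 * T n by near: n; exact: EC.
  by rewrite ler_pM2l.
pose X := T n `^ tau^-1; pose b := (2 * T n) `^ tau^-1.
have X0 : 0 < X by exact: powR_gt0.
have Xt : X `^ (- tau) = (T n)^-1.
  by rewrite -powRrM mulrN mulVf ?gt_eqF// powR_inv1// ltW.
pose w : R := n%:R `^ (- nu).
have w0 : 0 < w by exact: powR_gt0.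
have Xtb : X `^ (- (tau * beta1)) = w.
  rewrite -!powRrM; congr (_ `^ _); rewrite /nu; field.
  by rewrite !gt_eqF.
(* The balance that fixes the rate: the variance scale X^tau / n is the square of the bias scale
   w. *)
have Tw : T n = n%:R * w ^+ 2.
  have -> : n%:R * w ^+ 2 = n%:R `^ 1 * (w * w) by rewrite (powRr1 (ltW n0R)) expr2.
  have nE : (n%:R != 0 :> R) by rewrite gt_eqF.
  rewrite /w -!powRD ?nE ?implybT//.
  by congr (_ `^ _); rewrite /nu; field; rewrite gt_eqF.
have Xb : X < b.
  by rewrite gt0_ltr_powR ?invr_gt0 ?nnegrE ?mulr_ge0 ?(ltW T0)// ltr_pMl// ltr1n.
have CX : C * X `^ (- tau) <= 1 by rewrite Xt ler_pdivrMr// mul1r.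
have rho0 : 0 < rho n by rewrite mulr_gt0.
have C'X : C' * X `^ (- (tau * beta1)) <= rho n / 2.
  rewrite Xtb /rho -/w mulrAC ler_pM2r// ler_pdivlMr// mulrC.
  by move: z_ge0; rewrite /M; lra.
have [Psi PsiP] := pareto_test tau_gt0 C_gt0 C'_gt0 beta1_gt0 beta10 rho0 X0 Xb n0 CX C'X.
exists Psi.
have bound P F : has_df P F -> C / 2 * (2 * T n)^-1 <= 1 - F b ->
    F b / (n%:R * (rho n / (8 * (1 + C + C'))) ^+ 2 * (1 - F b)) <= alpha / 2.
  move=> PF Fb; have Fb0 : 0 < 1 - F b.
    by apply: lt_le_trans Fb; rewrite !mulr_gt0 ?invr_gt0 ?mulr_gt0.
  rewrite -/K /rho -/w ler_pdivrMr ?mulr_gt0 ?exprn_gt0 ?divr_gt0 ?mulr_gt0 ?invr_gt0 ?mulr_gt0//.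
  apply: (le_trans (df_le1 PF b)).
  have -> : alpha / 2 * (n%:R * (M * w / (8 * K)) ^+ 2 * (1 - F b)) =
      (alpha * C * M ^+ 2) / (2 * (16 * K) ^+ 2) * ((1 - F b) * (4 * (n%:R * w ^+ 2) / C)).
    by field; rewrite !gt_eqF.
  rewrite -Tw -[leLHS]mulr1; apply: ler_pM => //.
    by rewrite ler_pdivlMr ?mul1r// mulr_gt0 ?exprn_gt0 ?mulr_gt0.
  apply: le_trans (ler_wpM2r _ Fb); last by rewrite !mulr_ge0 ?invr_ge0 ?ltW.
  by rewrite le_eqVlt; apply/orP; left; apply/eqP; field; rewrite !gt_eqF.
have Gb1 (G : R -> R) : C / 2 * (2 * T n)^-1 <= 1 - G b -> G b < 1.
  by rewrite -subr_gt0; apply: lt_le_trans; rewrite !mulr_gt0 ?invr_gt0 ?mulr_gt0.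
rewrite /good_test (splitr alpha) EFinD; apply: leeD.
  apply: sup_risk_le => [|P G HG PG]; first by rewrite divr_ge0 ?ltW.
  have Gb : C / 2 * (2 * T n)^-1 <= 1 - G b.
    exact: tail0.
  by apply: (le_trans ((PsiP P G PG (Gb1 _ Gb)).1 HG)); rewrite lee_fin; exact: bound PG Gb.
apply: sup_risk_le => [|P G HG PG]; first by rewrite divr_ge0 ?ltW.
have Gb : C / 2 * (2 * T n)^-1 <= 1 - G b.
  exact: tail1 HG.1.
by apply: (le_trans ((PsiP P G PG (Gb1 _ Gb)).2 HG)); rewrite lee_fin; exact: bound PG Gb.
Unshelve. all: by end_near. Qed.

Lemma consistent_test_exists : exists rho : nat -> R,
  [/\ forall n, 0 <= rho n,
      (limn_esup (fun n => (rho n * n%:R `^ (beta1 / (2 * beta1 + 1)))%:E) < +oo)%E &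
      exists Psi : forall n, test n,
        uniformly_consistent alpha (fun=> pareto_class tau beta0 C C')
          (fun n => separated_class tau beta1 beta0 C C' (rho n)) Psi].
Proof.
exists rho; split.
- by move=> n; rewrite mulr_ge0 ?powR_ge0 ?ltW.
- have ucvg : (rho n * n%:R `^ nu)%:E @[n --> \oo] --> M%:E.
    apply: (@cvg_trans _ ((fun=> M%:E) @ \oo)); last exact: cvg_cst.
    apply: near_eq_cvg; near=> n.
    have n0R : 0 < n%:R :> R by rewrite ltr0n; near: n; exact: nbhs_infty_gt.
    by rewrite /rho -mulrA powRN mulVf ?mulr1// gt_eqF// powR_gt0.
  by rewrite (cvg_limn_einf_sup ucvg) ltry.
(* The implication makes the choice total: where no good test exists, an arbitrary one is taken. *)
- have ex n : exists Psi : test n, (exists Psi' : test n, good_test Psi') -> good_test Psi.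
    have [[Psi HPsi]|nPsi] := pselect (exists Psi' : test n, good_test Psi').
      by exists Psi.
    have [Psi _] := @set_test R n set0 measurable0.
    by exists Psi.
  exists (fun n => projT1 (cid (ex n))).
  by apply: filterS good_test_exists => n; exact: (projT2 (cid (ex n))).
Unshelve. all: by end_near. Qed.

End upper_bound.

(** * Densities and likelihoods *)

(** Normalisation leaves a measure of mass 1 unchanged and equips it with the [probability]
    structure. *)
Lemma measure_probability d (T : measurableType d) (R : realType)
    (mu : {measure set T -> \bar R}) :
  mu setT = 1%E -> exists P : probability T R, forall A, P A = mu A.
Proof.
move=> mu1; exists (mnormalize mu (dirac point : probability T R)) => A.
by rewrite /= /mnormalize mu1 onee_eq0 /= invr1 mule1.
Qed.

Lemma density_probability d (T : measurableType d) (R : realType)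
    (mu : {measure set T -> \bar R}) (g : T -> R) :
    (forall x, 0 <= g x) -> measurable_fun setT g ->
    (\int[mu]_x (g x)%:E = 1)%E ->
  exists nu : probability T R, forall A, nu A = (\int[mu]_(x in A) (g x)%:E)%E.
Proof.
move=> g0 mg g1; pose nu A := (\int[mu]_(x in A) (g x)%:E)%E.
have nu_set0 : nu set0 = 0%E by rewrite /nu integral_set0.
have nu_ge0 A : (0 <= nu A)%E by apply: integral_ge0 => x _; rewrite lee_fin.
have nu_additive : semi_sigma_additive nu.
  move=> F mF tF mUF; rewrite /nu ge0_integral_bigcup//=; last 2 first.
  - by apply/measurable_EFinP; exact: measurable_funTS.
  - by move=> x _; rewrite lee_fin.
  apply: is_cvg_ereal_nneg_natsum_cond => k _ _.
  by apply: integral_ge0 => x _; rewrite lee_fin.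
pose nu_measure : {measure set T -> \bar R} :=
  HB.pack nu (isMeasure.Build _ _ _ nu nu_set0 nu_ge0 nu_additive).
have [P PE] := measure_probability (mu := nu_measure) g1.
by exists P => A; rewrite PE.
Qed.

Section density.
Context d (T : measurableType d) (R : realType) (mu nu : {measure set T -> \bar R}).
Context (g : T -> R) (g_ge0 : forall x, 0 <= g x) (mg : measurable_fun setT g).
Context (nuE : forall A, measurable A -> nu A = (\int[mu]_(x in A) (g x)%:E)%E).
Local Open Scope ereal_scope.

Let mEg : measurable_fun setT (EFin \o g). Proof. exact/measurable_EFinP. Qed.

Let density_indic E : measurable E ->
  \int[nu]_x (\1_E x)%:E = \int[mu]_x ((\1_E x)%:E * (g x)%:E).
Proof.
move=> mE; rewrite integral_indic// setIT nuE//.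
rewrite integral_mkcond; apply: eq_integral => x _; rewrite patchE indicE.
by case: ifPn => xE; rewrite ?mul1e// mul0e.
Qed.

Import HBNNSimple.

Let density_nnsfun (f : {nnsfun T >-> R}) :
  \int[nu]_x (f x)%:E = \int[mu]_x ((f x)%:E * (g x)%:E).
Proof.
under [LHS]eq_integral do rewrite fimfunE -fsumEFin//.
rewrite [LHS]ge0_integral_fsum//; last 2 first.
  - by move=> r; exact/measurable_EFinP/measurableT_comp.
  - by move=> n x _; rewrite EFinM nnfun_muleindic_ge0.
under [RHS]eq_integral.
  move=> x xD; rewrite fimfunE -fsumEFin// ge0_mule_fsuml; last first.
    by move=> r; rewrite EFinM nnfun_muleindic_ge0.
  over.
rewrite [RHS]ge0_integral_fsum//; last 2 first.
  - move=> r; apply: emeasurable_funM => //; apply/measurable_EFinP.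
    exact: measurableT_comp.
  - by move=> n x _; rewrite EFinM mule_ge0 ?nnfun_muleindic_ge0// lee_fin.
apply: eq_fsbigr => r rf.
have r0 : (0 <= r)%R by move: rf; rewrite inE => -[x _ <-].
under eq_integral do rewrite EFinM.
under [RHS]eq_integral do rewrite EFinM -muleA.
rewrite !ge0_integralZl ?lee_fin//.
- by rewrite density_indic.
- by apply: emeasurable_funM => //; apply/measurable_EFinP.
- by move=> x _; rewrite mule_ge0// lee_fin.
- exact/measurable_EFinP.
Qed.

Lemma ge0_integral_density (f : T -> \bar R) : measurable_fun setT f ->
    (forall x, 0 <= f x) ->
  \int[nu]_x f x = \int[mu]_x (f x * (g x)%:E).
Proof.
move=> mf f0; pose f_ := nnsfun_approx measurableT mf.
have f_cvg x : (f_ n x)%:E @[n --> \oo] --> f x by apply: cvg_nnsfun_approx.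
have f_nd x : {homo (fun n => (f_ n x)%:E) : n m / (n <= m)%N >-> n <= m}.
  by move=> n m nm; rewrite lee_fin; exact/lefP/nd_nnsfun_approx.
transitivity (limn (fun n => \int[nu]_x (f_ n x)%:E)).
  rewrite -monotone_convergence//=.
  - by apply: eq_integral => x _; apply/esym/cvg_lim.
  - by move=> n; exact/measurable_EFinP.
  - by move=> n x _; rewrite lee_fin.
under eq_fun do rewrite density_nnsfun.
rewrite -monotone_convergence//=.
- apply: eq_integral => x _; apply/cvg_lim => //.
  exact: cvgeZr.
- by move=> n; apply: emeasurable_funM => //; exact/measurable_EFinP.
- by move=> n x _; rewrite mule_ge0// lee_fin.
- by move=> x _ n m nm; apply: lee_wpmul2r; [rewrite lee_fin|exact: f_nd].
Qed.

End density.

Definition likelihood d (T : measurableType d) (R : realType) (g : T -> R) n (X : n.-tuple T) : R :=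
  \prod_(x <- X) g x.

Arguments likelihood {d T R} g {n} X.

Section iid_integral.
Context d (T : measurableType d) (R : realType).
Local Open Scope ereal_scope.

Lemma ge0_integral_iid_lawS (P : probability T R) n (h : n.+1.-tuple T -> \bar R) :
    measurable_fun setT h -> (forall X, 0 <= h X) ->
  \int[iid_law P n.+1]_X h X =
    \int[P]_x \int[iid_law P n]_X h (cons_pair (x, X)).
Proof.
move=> mh h0; rewrite /= ge0_integral_distribution//=.
have mf : measurable_fun setT (h \o @cons_pair _ T n).
  by apply: measurableT_comp => //; exact: measurable_cons_pair.
apply: (@fubini_tonelli1 _ _ _ _ _ P (iid_law P n) (h \o @cons_pair _ T n) mf) => z.
exact: h0.
Qed.

Lemma measurable_iid_section n (h : n.+1.-tuple T -> \bar R) x :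
  measurable_fun setT h -> measurable_fun setT (fun X => h (cons_pair (x, X))).
Proof.
move=> mh; have mf : measurable_fun setT (h \o @cons_pair _ T n).
  by apply: measurableT_comp => //; exact: measurable_cons_pair.
exact: (measurableT_comp mf (pair1_measurable x)).
Qed.

Lemma measurable_iid_integral (P : probability T R) n (h : n.+1.-tuple T -> \bar R) :
    measurable_fun setT h -> (forall X, 0 <= h X) ->
  measurable_fun setT (fun x => \int[iid_law P n]_X h (cons_pair (x, X))).
Proof.
move=> mh h0; apply: (@measurable_fun_fubini_tonelli_F _ _ _ _ _ (iid_law P n) (h \o @cons_pair _ T n)).
  by apply: measurableT_comp => //; exact: measurable_cons_pair.
by move=> z /=.
Qed.

Lemma measurable_likelihood (g : T -> R) n : measurable_fun setT g ->
  measurable_fun setT (@likelihood _ T R g n).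
Proof.
move=> mg; rewrite (_ : likelihood g = fun X : n.-tuple T => (\prod_(i < n) g (tnth X i))%R).
  by apply: measurable_prod => i _; apply: measurableT_comp => //; exact: measurable_tnth.
by apply/funext => X; rewrite /likelihood big_tuple.
Qed.

Lemma likelihood_ge0 (g : T -> R) n (X : n.-tuple T) : (forall x, (0 <= g x)%R) -> (0 <= likelihood g X)%R.
Proof. by move=> g0; apply: prodr_ge0. Qed.

Lemma likelihood_cons (g : T -> R) n x (X : n.-tuple T) :
  likelihood g (cons_pair (x, X)) = (g x * likelihood g X)%R.
Proof. by rewrite /likelihood big_cons. Qed.

Lemma ge0_integral_iid_density (P Q : probability T R) (g : T -> R) n
    (h : n.-tuple T -> \bar R) :
    (forall x, (0 <= g x)%R) -> measurable_fun setT g ->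
    (forall A, measurable A -> Q A = \int[P]_(x in A) (g x)%:E) ->
    measurable_fun setT h -> (forall X, 0 <= h X) ->
  \int[iid_law Q n]_X h X = \int[iid_law P n]_X (h X * (likelihood g X)%:E).
Proof.
move=> g0 mg QE; elim: n h => [|n IHn] h mh h0.
  rewrite /= !integral_dirac//.
    by rewrite /likelihood big_nil !diracT !mul1e mule1.
  by apply: emeasurable_funM => //; apply/measurable_EFinP; exact: measurable_likelihood.
have mhl : measurable_fun setT (fun X => h X * (likelihood g X)%:E).
  by apply: emeasurable_funM => //; apply/measurable_EFinP; exact: measurable_likelihood.
rewrite !ge0_integral_iid_lawS//; last first.
  by move=> X; rewrite mule_ge0// lee_fin likelihood_ge0.
have mhx x := measurable_iid_section x mh.
under eq_integral do rewrite IHn//.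
(* Attaching the likelihood of the tail to a function on (n + 1)-tuples puts the inner integral in
   the form covered by [measurable_iid_integral]. *)
pose H := fun X : n.+1.-tuple T => h X * (likelihood g [tuple of behead X])%:E.
have mH : measurable_fun setT H.
  apply: emeasurable_funM => //; apply/measurable_EFinP.
  exact: (measurableT_comp (measurable_likelihood (n := n) mg) (@measurable_behead _ T n)).
have H0 X : 0 <= H X by rewrite mule_ge0// lee_fin likelihood_ge0.
have HE x (X : n.-tuple T) : H (cons_pair (x, X)) = h (cons_pair (x, X)) * (likelihood g X)%:E.
  by rewrite /H; congr (_ * (likelihood g _)%:E); apply/val_inj.
transitivity (\int[Q]_x \int[iid_law P n]_X H (cons_pair (x, X))).
  by apply: eq_integral => x _; apply: eq_integral => X _; rewrite HE.
rewrite (ge0_integral_density g0 mg QE); last 2 first.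
- exact: measurable_iid_integral.
- by move=> x; apply: integral_ge0.
apply: eq_integral => x _; rewrite -ge0_integralZr//.
- by apply: eq_integral => X _; rewrite HE likelihood_cons EFinM -muleA (muleC (g x)%:E).
- exact: measurable_iid_section.
- by rewrite lee_fin.
Qed.

(** Applied to the square of a density, c is one plus the chi-square divergence of a single
    observation, so this is its tensorisation. *)
Lemma integral_likelihood (P : probability T R) (g : T -> R) (c : R) n :
    (forall x, (0 <= g x)%R) -> measurable_fun setT g -> \int[P]_x (g x)%:E = c%:E ->
  \int[iid_law P n]_X (likelihood g X)%:E = (c ^+ n)%:E.
Proof.
move=> g0 mg gc; have mEg : measurable_fun setT (EFin \o g) by exact/measurable_EFinP.
elim: n => [|n IHn].
  rewrite /= integral_dirac//.
    by rewrite /likelihood big_nil diracT mul1e.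
  by apply/measurable_EFinP; exact: measurable_likelihood.
rewrite ge0_integral_iid_lawS//; last 2 first.
- by apply/measurable_EFinP; exact: measurable_likelihood.
- by move=> X; rewrite lee_fin likelihood_ge0.
transitivity (\int[P]_x ((g x)%:E * (c ^+ n)%:E)).
  apply: eq_integral => x _; rewrite -IHn -ge0_integralZl ?lee_fin//.
  - by apply: eq_integral => X _; rewrite likelihood_cons EFinM.
  - by apply/measurable_EFinP; exact: measurable_likelihood.
  - by move=> X _; rewrite lee_fin likelihood_ge0.
have c0 : (0 <= c)%R by rewrite -lee_fin -gc; apply: integral_ge0 => x _; rewrite lee_fin.
rewrite ge0_integralZr ?lee_fin ?exprn_ge0//; last by move=> x _; rewrite lee_fin.
by rewrite gc -EFinM exprS.
Qed.

End iid_integral.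

Lemma integral_affine_indic d (T : measurableType d) (R : realType)
    (mu : {measure set T -> \bar R}) (A B : set T) (a b : R) :
    measurable A -> measurable B -> 0 <= a -> 0 <= b ->
  (\int[mu]_(x in A) (a + b * \1_B x)%:E = a%:E * mu A + b%:E * mu (A `&` B))%E.
Proof.
move=> mA mB a0 b0; under eq_integral do rewrite EFinD EFinM.
have mI : measurable_fun A (fun x => (\1_B x : R)%:E).
  by apply/measurable_EFinP/measurable_funTS; exact: measurable_indic.
rewrite ge0_integralD//.
- rewrite integral_cst// ge0_integralZl ?lee_fin//.
  by rewrite integral_indic// setIC.
- by move=> x _; rewrite -EFinM lee_fin mulr_ge0.
- by apply: emeasurable_funM.
Qed.

Lemma probability_integral_affine d (T : measurableType d) (R : realType)
    (P : probability T R) (B : set T) (a b : R) :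
    measurable B -> 0 <= a -> 0 <= b ->
  (\int[P]_x (a + b * \1_B x)%:E = (a + b * fine (P B))%:E)%E.
Proof.
move=> mB a0 b0; rewrite integral_affine_indic// setTI EFinD EFinM.
rewrite fineK ?fin_num_measure//.
by congr (_ + _)%E; rewrite -[RHS]mule1; congr (_ * _)%E; exact: probability_setT.
Qed.

Section perturbation.
Context d (T : measurableType d) (R : realType) (P : probability T R).
Local Open Scope ereal_scope.

Context (I1 I2 : set T) (s dlt : R).
Context (mI1 : measurable I1) (mI2 : measurable I2) (I12 : I1 `&` I2 = set0).
Context (PI1 : P I1 = s%:E) (PI2 : P I2 = s%:E).
Context (dlt_ge0 : (0 <= dlt)%R) (dlt_le1 : (dlt <= 1)%R).

Let g (x : T) : R := (1 + dlt * (\1_I1 x - \1_I2 x))%R.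

Let in_both x : x \in I1 -> x \in I2 -> False.
Proof. by move=> /set_mem x1 /set_mem x2; have : (I1 `&` I2) x by []; rewrite I12. Qed.

Let g_ge0 x : (0 <= g x)%R.
Proof.
by move: dlt_ge0 dlt_le1; rewrite /g !indicE; case: (x \in I1); case: (x \in I2) => /=; lra.
Qed.

Let mg : measurable_fun setT g.
Proof.
apply: measurable_funD => //; apply: measurable_funM => //.
by apply: measurable_funB; exact: measurable_indic.
Qed.

(** The negative part of the perturbation is moved to the other side, so that only nonnegative
    integrands occur and additivity needs no integrability argument. The second moment below is
    treated in the same way. *)
Let g_mass A : measurable A ->
  \int[P]_(x in A) (g x)%:E + dlt%:E * P (A `&` I2) = P A + dlt%:E * P (A `&` I1).
Proof.
move=> mA; rewrite -[P A in RHS]mul1e -integral_affine_indic//.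
have -> : dlt%:E * P (A `&` I2) = \int[P]_(x in A) (0 + dlt * \1_I2 x)%:E.
  by rewrite integral_affine_indic// mul0e add0e.
rewrite -ge0_integralD//.
- by apply: eq_integral => x _; rewrite -EFinD; congr EFin; rewrite /g; ring.
- by move=> x _; rewrite lee_fin.
- exact/measurable_EFinP/measurable_funTS.
- by move=> x _; rewrite lee_fin add0r mulr_ge0.
- apply/measurable_EFinP/measurable_funTS; apply: measurable_funD => //.
  by apply: measurable_funM => //; exact: measurable_indic.
Qed.

Let g_mass1 : \int[P]_x (g x)%:E = 1.
Proof.
have := g_mass measurableT; rewrite !setTI PI1 PI2 probability_setT.
by rewrite -EFinM => /(congr1 (fun z => z - (dlt * s)%:E)); rewrite !addeK.
Qed.

Let g_mass2 : \int[P]_x (g x ^+ 2)%:E = (1 + 2 * dlt ^+ 2 * s)%:E.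
Proof.
have s0 : (0 <= s)%R by rewrite -lee_fin -PI1.
have m2 : measurable_fun setT (fun x => g x ^+ 2)%R by exact: measurable_funX.
have : \int[P]_x (g x ^+ 2)%:E + \int[P]_x (0 + (2 * dlt) * \1_I2 x)%:E =
    \int[P]_x (1 + (2 * dlt + dlt ^+ 2) * \1_I1 x)%:E +
    \int[P]_x (0 + dlt ^+ 2 * \1_I2 x)%:E.
  rewrite -!ge0_integralD//.
  - apply: eq_integral => x _; rewrite -!EFinD; congr EFin; rewrite /g !indicE.
    by case: (boolP (x \in I1)) => x1; case: (boolP (x \in I2)) => x2 /=;
      [have := in_both x1 x2|ring|ring|ring].
  - by move=> x _; rewrite lee_fin addr_ge0 ?mulr_ge0 ?addr_ge0 ?mulr_ge0 ?sqr_ge0.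
  - apply/measurable_EFinP; apply: measurable_funD => //.
    by apply: measurable_funM => //; exact: measurable_indic.
  - by move=> x _; rewrite lee_fin add0r mulr_ge0 ?sqr_ge0.
  - apply/measurable_EFinP; apply: measurable_funD => //.
    by apply: measurable_funM => //; exact: measurable_indic.
  - by move=> x _; rewrite lee_fin sqr_ge0.
  - exact/measurable_EFinP.
  - by move=> x _; rewrite lee_fin add0r !mulr_ge0.
  - apply/measurable_EFinP; apply: measurable_funD => //.
    by apply: measurable_funM => //; exact: measurable_indic.
rewrite !probability_integral_affine ?addr_ge0 ?mulr_ge0 ?sqr_ge0//.
rewrite PI1 PI2 /= !add0r -!EFinD.
move=> /(congr1 (fun z => z - (2 * dlt * s)%:E)); rewrite addeK// => ->.
by rewrite -EFinB; congr EFin; ring.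
Qed.

(* Integrating the pointwise bound 2 lam (L - 1) 1_A <= (L - 1)^2 + lam^2 for the
   likelihood ratio L. *)
Lemma perturbed_probability : exists Q : probability T R,
  (forall A, measurable A ->
    Q A + dlt%:E * P (A `&` I2) = P A + dlt%:E * P (A `&` I1)) /\
  (forall n (A : set (n.-tuple T)) (lam : R), measurable A -> (0 <= lam)%R ->
    (2 * lam * fine (iid_law Q n A) + 2 <=
      (1 + 2 * dlt ^+ 2 * s) ^+ n + 1 + lam ^+ 2
      + 2 * lam * fine (iid_law P n A))%R).
Proof.
have [Q QE] := density_probability g_ge0 mg g_mass1; exists Q; split.
  by move=> A mA; rewrite QE g_mass.
move=> n A lam mA lam0.
have lam2 : (0 <= 2 * lam)%R by rewrite mulr_ge0.
have maff (a b : R) : measurable_fun setT (fun X : n.-tuple T => a + b * \1_A X)%R.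
  by apply: measurable_funD => //; apply: measurable_funM => //; exact: measurable_indic.
have mL := @measurable_likelihood _ T R g n mg.
have L2E (X : n.-tuple T) : (likelihood g X ^+ 2)%R = likelihood (fun x => g x ^+ 2)%R X.
  by rewrite /likelihood prodrXl.
have intL2 : \int[iid_law P n]_X (likelihood g X ^+ 2)%:E = ((1 + 2 * dlt ^+ 2 * s) ^+ n)%:E.
  under eq_integral do rewrite L2E.
  apply: integral_likelihood => //; first by move=> x; exact: sqr_ge0.
  exact: measurable_funX.
(* Both sides become integrals under [iid_law P n]: of (2 + 2 lam 1_A) L on the left and of L^2 + 1
   + lam^2 + 2 lam 1_A on the right. Their difference is (L - 1 - lam)^2 on A and (L - 1)^2 + lam^2
   off A. *)
rewrite -lee_fin [leLHS](_ : _ = (2 + 2 * lam * fine (iid_law Q n A))%:E); last first.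
  by rewrite addrC.
rewrite -probability_integral_affine// (ge0_integral_iid_density (P := P) (g := g))//; last 2 first.
- by apply/measurable_EFinP.
- by move=> X; rewrite lee_fin addr_ge0 ?mulr_ge0.
rewrite [leRHS](_ : _ = ((1 + 2 * dlt ^+ 2 * s) ^+ n)%:E +
    (1 + lam ^+ 2 + 2 * lam * fine (iid_law P n A))%:E); last first.
  by rewrite -EFinD !addrA.
rewrite -probability_integral_affine ?addr_ge0 ?sqr_ge0// -intL2 -ge0_integralD//; last 4 first.
- by move=> X _; rewrite lee_fin sqr_ge0.
- by apply/measurable_EFinP; exact: measurable_funX.
- by move=> X _; rewrite lee_fin !addr_ge0 ?mulr_ge0 ?sqr_ge0.
- by apply/measurable_EFinP.
apply: ge0_le_integral => //.
- by move=> X _; rewrite -EFinM lee_fin mulr_ge0 ?likelihood_ge0// addr_ge0 ?mulr_ge0.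
- apply: emeasurable_funM; first by apply/measurable_EFinP.
  by apply/measurable_EFinP.
- apply: emeasurable_funD; first by apply/measurable_EFinP; exact: measurable_funX.
  by apply/measurable_EFinP.
- move=> X _; rewrite -EFinM -EFinD lee_fin indicE.
  set L := likelihood g X; rewrite -subr_ge0.
  case: (X \in A) => /=.
    rewrite (_ : _ - _ = (L - 1 - lam) ^+ 2)%R; first exact: sqr_ge0.
    by ring.
  rewrite (_ : _ - _ = (L - 1) ^+ 2 + lam ^+ 2)%R; first by rewrite addr_ge0 ?sqr_ge0.
  by ring.
Qed.

End perturbation.

(** * Lower bound *)

Lemma df_itv (R : realType) (P : probability (measurableTypeR R) R) (F : R -> R) (a b : R) :
  has_df P F -> a <= b -> P `]a, b]%classic = (F b - F a)%:E.
Proof.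
move=> PF ab.
have -> : `]a, b]%classic = `]-oo, b]%classic `\` `]-oo, a]%classic.
  apply/seteqP; split=> x /=; rewrite !in_itv/=.
    by move=> /andP[ax xb]; split => //; apply/negP; rewrite -ltNge.
  by move=> [-> /negP]; rewrite -ltNge => ->.
have -> : P (`]-oo, b]%classic `\` `]-oo, a]%classic) =
    (P `]-oo, b]%classic - P (`]-oo, b]%classic `&` `]-oo, a]%classic))%E.
  by apply: measureD => //; rewrite -ge0_fin_numE// fin_num_measure.
by rewrite setIidr ?PF -?EFinB//; exact: subset_itvl.
Qed.

(** The parameter y is a value of x^(-tau). The three smallness conditions keep F positive at the
    midpoint of the perturbation, keep the density nonnegative, and make the band of S(beta0) at the
    midpoint at most half of the perturbation. The other half, multiplied by x^tau = 1 / (2 y), is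
    the separation C' y^beta1 / 4. *)
Lemma pareto_alternative (R : realType) (tau C C' beta1 : R) (beta0 : \bar R) (y : R) :
    0 < tau -> 0 < C -> 0 < C' -> 0 < beta1 -> 0 < y -> 4 * C * y <= 1 ->
    C' * y `^ beta1 <= C ->
    (beta1%:E < beta0)%E ->
    (forall b0, beta0 = b0%:E -> 2 * (2 * y) `^ (b0 + 1) <= y `^ (beta1 + 1)) ->
  exists P Q : probability (measurableTypeR R) R, exists F : R -> R,
  [/\ has_df P (exact_pareto tau C), has_df Q F,
    separated_class tau beta1 beta0 C C' (C' * y `^ beta1 / 4) F &
    forall n (A : set (n.-tuple (measurableTypeR R))) (lam : R), measurable A -> 0 <= lam ->
    2 * lam * fine (iid_law Q n A) + 2 <=
      (1 + 2 * C' ^+ 2 / C * y `^ (2 * beta1 + 1)) ^+ n + 1 + lam ^+ 2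
      + 2 * lam * fine (iid_law P n A)].
Proof.
move=> tau0 C0 C'0 b1_gt0 y0 y1 yC b10 yb.
have [P P1 PF] := exact_pareto_nonneg_df tau0 C0.
set F0 := exact_pareto tau C in PF *.
(* The amplitude is the largest allowed by the band of S(beta1): [dlt] * s = C' y^(beta1 + 1), its
   half-width at the right end of the perturbed range. *)
pose s := C * y; pose dlt := C' * y `^ beta1 / C.
have s0 : 0 < s by exact: mulr_gt0.
have s4 : 4 * s <= 1 by rewrite /s mulrA.
have yn : y != 0 by rewrite gt_eqF.
have yb0 : 0 < y `^ beta1 by exact: powR_gt0.
have dlt0 : 0 < dlt by rewrite divr_gt0// mulr_gt0.
have dlt1 : dlt <= 1 by rewrite ler_pdivrMr// mul1r.
have dist_le (a b : R) : 0 <= a <= s -> 0 <= b <= s -> `|a - b| <= s.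
  by move=> /andP[a0 a1] /andP[c0 c1]; rewrite ler_norml; apply/andP; split; lra.
have ds0 : 0 < dlt * s by exact: mulr_gt0.
have dss : dlt * s <= s by rewrite ler_piMl// ltW.
have s3 : 3 * s <= 1 by lra.
have F2_bounds : 0 < 1 - 2 * s - dlt * s < 1 by apply/andP; split; lra.
have F2_half : dlt * s / 2 <= 1 - 2 * s - dlt * s by lra.
have ds_half : dlt * s / 2 <= dlt * s by lra.
have band_sep (v h : R) : h <= dlt * s / 2 -> `|1 - v - 2 * s| <= h ->
    dlt * s / 2 <= `|v - (1 - 2 * s - dlt * s)|.
  move=> hs /le_trans/(_ hs); rewrite ler_norml => /andP[v1 v2].
  by rewrite ger0_norm; lra.
(* The points decrease in j, and the Pareto tail at [x_ j] is j s for j <= 3, so consecutive points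
   enclose probability s. *)
pose x_ (j : R) : R := (j * y) `^ (- tau^-1).
have x_gt0 j : 0 < j -> 0 < x_ j by move=> j0; rewrite powR_gt0// mulr_gt0.
have x_t j : 0 < j -> x_ j `^ (- tau) = j * y.
  by move=> j0; rewrite -powRrM mulrNN mulVf ?gt_eqF// powRr1// ltW// mulr_gt0.
have x_le i j : 0 < i -> i <= j -> x_ j <= x_ i.
  move=> i0 ij; rewrite powR_decreasing ?ler_pM2r ?mulr_gt0// ltW// invr_gt0//.
have F0x j : 0 < j -> j <= 3 -> F0 (x_ j) = 1 - j * s.
  move=> j0 j3; rewrite /F0 exact_paretoE ?x_gt0// x_t// max_r /s; first by ring.
  by rewrite mulrCA -/s; nra.
pose I1 := `]x_ 2, x_ 1]%classic : set (measurableTypeR R).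
pose I2 := `]x_ 3, x_ 2]%classic : set (measurableTypeR R).
have I12 : I1 `&` I2 = set0.
  rewrite -subset0 /I1 /I2 => x [] /=; rewrite !in_itv/= => /andP[+ _] /andP[_].
  by move=> /lt_le_trans h /h; rewrite ltxx.
have x12 : x_ 2 <= x_ 1 by apply: x_le => //; lra.
have x23 : x_ 3 <= x_ 2 by apply: x_le => //; lra.
have F01 : F0 (x_ 1) = 1 - s by rewrite F0x ?mul1r//; lra.
have F02 : F0 (x_ 2) = 1 - 2 * s by rewrite F0x//; lra.
have F03 : F0 (x_ 3) = 1 - 3 * s by rewrite F0x//; lra.
have PI1 : P I1 = s%:E.
  by rewrite (df_itv PF x12) F01 F02; congr EFin; ring.
have PI2 : P I2 = s%:E.
  by rewrite (df_itv PF x23) F02 F03; congr EFin; ring.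
have mI1 : measurable I1 by exact: measurable_itv.
have mI2 : measurable I2 by exact: measurable_itv.
have [Q [QE Qtest]] := perturbed_probability mI1 mI2 I12 PI1 PI2 (ltW dlt0) dlt1.
pose D1 x := fine (P (`]-oo, x]%classic `&` I1)).
pose D2 x := fine (P (`]-oo, x]%classic `&` I2)).
pose F x := F0 x + dlt * (D1 x - D2 x).
have QF : has_df Q F.
  move=> x; have := QE `]-oo, x]%classic (measurable_itv _).
  rewrite PF => /(congr1 (fun z => z - dlt%:E * P (`]-oo, x]%classic `&` I2))%E).
  have Pfin A : measurable A -> P A \is a fin_num by move=> mA; exact: fin_num_measure.
  have mx1 : measurable (`]-oo, x]%classic `&` I1 : set (measurableTypeR R)) by exact: measurableI.
  have mx2 : measurable (`]-oo, x]%classic `&` I2 : set (measurableTypeR R)) by exact: measurableI.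
  rewrite -(fineK (Pfin _ mx1)) -(fineK (Pfin _ mx2)) -/(D1 x) -/(D2 x) -!EFinM addeK// => ->.
  by rewrite -?EFinD -?EFinB; congr EFin; rewrite /F; ring.
have D_bound I : measurable I -> P I = s%:E -> forall x,
    0 <= fine (P (`]-oo, x]%classic `&` I)) <= s.
  move=> mI PI x; rewrite fine_ge0//= -lee_fin fineK; last first.
    by apply: fin_num_measure; exact: measurableI.
  rewrite -PI; apply: le_measure; rewrite ?inE//; first exact: measurableI.
have D12 x : `|D1 x - D2 x| <= s.
  exact: dist_le (D_bound _ mI1 PI1 x) (D_bound _ mI2 PI2 x).
have D0 (a b x : R) : x <= a -> P (`]-oo, x]%classic `&` `]a, b]%classic) = 0%E.
  move=> xa; rewrite (_ : _ `&` _ = set0) ?measure0//.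
  rewrite -subset0 => z [] /=; rewrite !in_itv/= => zx /andP[az _].
  by have := lt_le_trans az (le_trans zx xa); rewrite ltxx.
have Dfull (a b x : R) : b <= x -> `]-oo, x]%classic `&` `]a, b]%classic = `]a, b]%classic.
  move=> bx; apply: setIidr => z /=; rewrite !in_itv/= => /andP[_ zb].
  exact: le_trans bx.
have FF0_left x : x <= x_ 3 -> F x = F0 x.
  move=> x3; rewrite /F /D1 /D2 /I1 /I2 !D0 ?(le_trans x3)// subrr mulr0 addr0//.
have FF0_right x : x_ 1 <= x -> F x = F0 x.
  move=> x1; rewrite /F /D1 /D2 /I1 /I2 !Dfull ?(le_trans _ x1)//.
  by rewrite -/I1 -/I2 PI1 PI2 subrr mulr0 addr0.
have Fx2 : F (x_ 2) = 1 - 2 * s - dlt * s.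
  rewrite /F /D1 /D2 /I1 /I2 D0// Dfull// -/I2 PI2 F02.
  by rewrite /=; ring.
have F_df : nonneg_df F.
  exists Q => //.
  have sub j k : 0 < j -> `[0, +oo[%classic `&` `]x_ j, x_ k]%classic = `]x_ j, x_ k]%classic.
    move=> j0; apply: setIidr => z /=; rewrite !in_itv/= andbT => /andP[jz _].
    by rewrite (le_trans _ (ltW jz))// ltW// x_gt0.
  have := QE `[0, +oo[%classic (measurable_itv _).
  rewrite !sub// -/I1 -/I2 PI1 PI2 P1 -EFinM => /(congr1 (fun z => z - (dlt * s)%:E)%E).
  by rewrite !addeK.
have dlts : dlt * s = C' * y `^ (beta1 + 1).
  rewrite powRD ?yn ?implybT// (powRr1 (ltW y0)) /dlt /s; field.
  by rewrite gt_eqF.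
have HF : pareto_class tau beta1%:E C C' F.
  split => // x x0 Fx.
  have [x3|x3] := leP x (x_ 3).
    rewrite FF0_left// in Fx *.
    exact: (exact_pareto_class tau0 C0 C'0 beta1).2.
  have [x1|x1] := leP (x_ 1) x.
    rewrite FF0_right// in Fx *.
    exact: (exact_pareto_class tau0 C0 C'0 beta1).2.
  (* To the left of [x_ 1] the band is at least as wide as at [x_ 1], so its half-width there bounds
     the perturbation everywhere. *)
  have yx : y <= x `^ (- tau).
    by rewrite -[y in leLHS]mul1r -x_t// powR_decreasing// ltW.
  have yx3 : x `^ (- tau) <= 3 * y.
    by rewrite -x_t// powR_decreasing ?x_gt0// ltW.
  have -> : 1 - F x - C * x `^ (- tau) = - (dlt * (D1 x - D2 x)).
    rewrite /F /F0 exact_paretoE// max_r; first by ring.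
    rewrite subr_ge0; apply: (@le_trans _ _ (C * (3 * y))); first by rewrite ler_pM2l.
    by rewrite mulrCA.
  rewrite normrN normrM gtr0_norm//; apply: (@le_trans _ _ (dlt * s)).
    by rewrite ler_pM2l.
  rewrite dlts ler_pM2l//.
  have -> : x `^ (- (tau * (beta1 + 1))) = (x `^ (- tau)) `^ (beta1 + 1).
    by rewrite -powRrM mulNr.
  by rewrite ge0_ler_powR ?nnegrE ?powR_ge0 ?(ltW y0) ?addr_ge0 ?(ltW b1_gt0).
exists P, Q, F; split => //; last first.
  move=> n A lam mA lam0; have := Qtest n A lam mA lam0.
  suff -> : 2 * dlt ^+ 2 * s = 2 * C' ^+ 2 / C * y `^ (2 * beta1 + 1) by [].
  have -> : y `^ (2 * beta1 + 1) = y `^ beta1 * y `^ beta1 * y.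
    have -> : 2 * beta1 + 1 = beta1 + beta1 + 1 by ring.
    by rewrite !powRD ?yn ?implybT// (powRr1 (ltW y0)).
  by rewrite /dlt /s; field; rewrite gt_eqF.
split => //; apply: le_ereal_inf_tmp => _ [G HG <-].
(* The supremum is tested at [x_ 2], the common endpoint of the two intervals, where F has lost the
   full amount [dlt] * s. *)
have F2gt : 0 < F (x_ 2) < 1.
  by rewrite Fx2.
apply: (@le_trans _ _ (`|x_ 2 `^ tau * (1 - F (x_ 2)) - x_ 2 `^ tau * (1 - G (x_ 2))|%:E)); last first.
  by apply: ereal_sup_ubound; exists (x_ 2).
have x20 : 0 < x_ 2 by exact: x_gt0.
rewrite lee_fin -mulrBr normrM (gtr0_norm (powR_gt0 tau x20)).
have -> : x_ 2 `^ tau = (2 * y)^-1.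
  by rewrite -x_t// powRN invrK.
have y2 : 0 < 2 * y by exact: mulr_gt0.
rewrite ler_pdivlMl//.
have -> : 2 * y * (C' * y `^ beta1 / 4) = dlt * s / 2.
  by rewrite /dlt /s; field; rewrite gt_eqF.
rewrite (_ : 1 - F (x_ 2) - (1 - G (x_ 2)) = G (x_ 2) - F (x_ 2)); last by ring.
case: beta0 b10 yb HG => [b0||//].
  move=> b10 /(_ _ erefl) yb [[PG _ PGG] band].
  (* A law vanishing at [x_ 2] is not constrained by the band there, but F is bounded away from 0 at
     that point. *)
  have := df_ge0 PGG (x_ 2); rewrite le_eqVlt => /predU1P[<-|G0].
    rewrite sub0r normrN Fx2 ger0_norm//; apply: ltW; by case/andP: F2_bounds.
  have := band (x_ 2) x20; rewrite G0 (df_le1 PGG) => /(_ isT).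
  rewrite x_t// (_ : C * (2 * y) = 2 * s); last by rewrite /s; ring.
  have -> : x_ 2 `^ (- (tau * (b0 + 1))) = (2 * y) `^ (b0 + 1).
    by rewrite -mulNr powRrM x_t.
  have : C' * (2 * y) `^ (b0 + 1) <= dlt * s / 2.
    by rewrite dlts -mulrA ler_pM2l// ler_pdivlMr// mulrC.
  by rewrite Fx2; exact: band_sep.
move=> _ _ ->; rewrite -/F0 Fx2 F02.
rewrite (_ : _ - _ = dlt * s); last by ring.
by rewrite gtr0_norm.
Qed.

Lemma sup_risk_ge (R : realType) n (H : set (R -> R)) (P : probability (measurableTypeR R) R)
    (F : R -> R) (f : n.-tuple (measurableTypeR R) -> R) :
  H F -> has_df P F -> ('E_(iid_law P n)[f] <= sup_risk H f)%E.
Proof.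
move=> HF PF; rewrite /sup_risk le_max; apply/orP; right.
by apply: ereal_sup_ubound; exists P => //; exists F.
Qed.

Lemma limn_einf_ge (R : realType) (u : (\bar R)^nat) (c : \bar R) :
  (\forall n \near \oo, (c <= u n)%E) -> (c <= limn_einf u)%E.
Proof.
move=> [N _ Nu]; rewrite limn_einf_lim; apply: lime_ge; first exact: is_cvg_einfs.
near=> n; apply: le_ereal_inf_tmp => _ [k /= nk <-]; apply: Nu => /=.
by apply: leq_trans nk; near: n; exact: nbhs_infty_ge.
Unshelve. all: by end_near. Qed.

(** With p the level and q the power, the likelihood bound yields q - p <= lam = (1 - alpha) / 2,
    while a total risk of at most alpha forces q - p >= 1 - alpha. *)
Lemma two_point_risk (R : realFieldType) (alpha p q L : R) : alpha < 1 ->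
    let lam := (1 - alpha) / 2 in
    L <= 1 + lam ^+ 2 ->
    2 * lam * q + 2 <= L + 1 + lam ^+ 2 + 2 * lam * p -> p + (1 - q) <= alpha ->
  False.
Proof.
move=> alpha1 lam HL Hlrt Hrisk; have lam0 : 0 < lam by rewrite divr_gt0// subr_gt0.
have : lam * (q - p) <= lam * lam by move: HL Hlrt; rewrite expr2; lra.
by rewrite ler_pM2l//; move: Hrisk alpha1; rewrite /lam; lra.
Qed.

Section lower_bound.
Context (R : realType) (alpha tau C C' beta1 : R) (beta0 : \bar R).
Context (alpha_gt0 : 0 < alpha) (tau_gt0 : 0 < tau) (C_gt0 : 0 < C)
  (C'_gt0 : 0 < C') (beta1_gt0 : 0 < beta1) (beta10 : (beta1%:E < beta0)%E)
  (alpha_lt1 : alpha < 1).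

Let nu := beta1 / (2 * beta1 + 1).
Let lam := (1 - alpha) / 2.
(** Chosen so that the chi-square divergence of one observation is exactly ln (1 + lam^2) / n; by 1
    + u <= exp u its n-fold product stays below 1 + lam^2. *)
Let theta := (C * ln (1 + lam ^+ 2) / (2 * C' ^+ 2)) `^ (2 * beta1 + 1)^-1.
Let y (n : nat) : R := theta * n%:R `^ (- (2 * beta1 + 1)^-1).

Let den_gt0 : 0 < 2 * beta1 + 1.
Proof. by rewrite addr_gt0// mulr_gt0. Qed.

Let lam_gt0 : 0 < lam.
Proof. by rewrite divr_gt0// subr_gt0. Qed.

Let theta_base_gt0 : 0 < C * ln (1 + lam ^+ 2) / (2 * C' ^+ 2).
Proof.
rewrite divr_gt0 ?mulr_gt0 ?exprn_gt0// ln_gt0// ltrDl exprn_gt0//.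
Qed.

Let theta_gt0 : 0 < theta.
Proof. exact: powR_gt0. Qed.

Let likelihood_bound n : (0 < n)%N ->
  (1 + 2 * C' ^+ 2 / C * y n `^ (2 * beta1 + 1)) ^+ n <= 1 + lam ^+ 2.
Proof.
move=> n0; have n0R : 0 < n%:R :> R by rewrite ltr0n.
have l2 : 0 < 1 + lam ^+ 2 by rewrite ltr_wpDr ?sqr_ge0.
have -> : 2 * C' ^+ 2 / C * y n `^ (2 * beta1 + 1) = ln (1 + lam ^+ 2) / n%:R.
  have th : theta `^ (2 * beta1 + 1) = C * ln (1 + lam ^+ 2) / (2 * C' ^+ 2).
    by rewrite -powRrM mulVf ?gt_eqF// powRr1// ltW.
  have nn : (n%:R `^ (- (2 * beta1 + 1)^-1)) `^ (2 * beta1 + 1) = n%:R^-1 :> R.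
    by rewrite -powRrM mulNr mulVf ?gt_eqF// powR_inv1// ltW.
  rewrite powRM ?powR_ge0// th nn; field.
  by rewrite !gt_eqF.
have l0 : 0 <= ln (1 + lam ^+ 2) / n%:R.
  by rewrite divr_ge0 ?(ltW n0R)// ln_ge0// lerDl sqr_ge0.
apply: (@le_trans _ _ (expR (ln (1 + lam ^+ 2) / n%:R) ^+ n)).
  by rewrite lerXn2r ?nnegrE ?addr_ge0 ?expR_ge0// expR_ge1Dx.
by rewrite -expRM_natl -mulrC divfK ?gt_eqF// lnK.
Qed.

(** All three conditions bound a positive power of y_n, which tends to 0. In the last one that power
    is b0 - beta1, obtained after division by y^(beta1 + 1). *)
Let admissible : \forall n \near \oo,
  [/\ 4 * C * y n <= 1, C' * y n `^ beta1 <= C &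
    forall b0, beta0 = b0%:E -> 2 * (2 * y n) `^ (b0 + 1) <= y n `^ (beta1 + 1)].
Proof.
have invcvg : (y n)^-1 @[n --> \oo] --> +oo.
  have Tcvg : (n%:R `^ (2 * beta1 + 1)^-1 : R) @[n --> \oo] --> +oo.
    by apply: cvg_natr_powR; rewrite invr_gt0.
  apply/cvgryPge => A; near=> n.
  rewrite /y invfM powRN invrK mulrC ler_pdivlMr//.
  by near: n; exact: ((cvgryPge _).1 Tcvg).
have small (b c : R) : 0 < b -> 0 < c -> \forall n \near \oo, y n `^ b <= c.
  move=> b0 c0; have lim0 := powR_cvgNy b0.
  have ev := invcvg _ (cvgr_le _ lim0 _ c0).
  near=> n; have n0 : (0 < n)%N by near: n; exact: nbhs_infty_gt.
  have y0 : 0 < y n by rewrite mulr_gt0// powR_gt0// ltr0n.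
  have -> : y n `^ b = (y n)^-1 `^ (- b).
    by rewrite -powR_inv1 ?(ltW y0)// -powRrM mulrNN mul1r.
  by near: n; exact: ev.
have ev1 : \forall n \near \oo, y n `^ 1 <= (4 * C)^-1.
  by apply: small; rewrite ?invr_gt0 ?mulr_gt0.
have ev2 : \forall n \near \oo, y n `^ beta1 <= C / C'.
  by apply: small; rewrite ?divr_gt0.
have ev3 : \forall n \near \oo, forall b0, beta0 = b0%:E ->
    y n `^ (b0 - beta1) <= (2 * 2 `^ (b0 + 1))^-1.
  case: beta0 beta10 => [b0||//]; last by move=> _; apply: nearW => n b0.
  rewrite lte_fin => b10.
  have : \forall n \near \oo, y n `^ (b0 - beta1) <= (2 * 2 `^ (b0 + 1))^-1.
    by apply: small; rewrite ?subr_gt0// invr_gt0 mulr_gt0// powR_gt0.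
  by apply: filterS => n Hn _ [<-].
near=> n; have n0 : (0 < n)%N by near: n; exact: nbhs_infty_gt.
have y0 : 0 < y n by rewrite mulr_gt0// powR_gt0// ltr0n.
have yn : y n != 0 by rewrite gt_eqF.
have h1 : y n `^ 1 <= (4 * C)^-1 by near: n; exact: ev1.
have h2 : y n `^ beta1 <= C / C' by near: n; exact: ev2.
have h3 : forall b0, beta0 = b0%:E -> y n `^ (b0 - beta1) <= (2 * 2 `^ (b0 + 1))^-1.
  by near: n; exact: ev3.
split.
- by move: h1; rewrite powRr1 ?(ltW y0)// -[_^-1]mul1r ler_pdivlMr ?mulr_gt0// mulrC.
- by move: h2; rewrite ler_pdivlMr// mulrC.
- move=> b0 b0E; have := h3 b0 b0E.
  rewrite -[_^-1]mul1r ler_pdivlMr ?mulr_gt0 ?powR_gt0// => h.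
  rewrite powRM// ?(ltW y0)//.
  have -> : y n `^ (b0 + 1) = y n `^ (b0 - beta1) * y n `^ (beta1 + 1).
    by rewrite -powRD ?yn ?implybT//; congr (_ `^ _); ring.
  rewrite (_ : _ * _ = y n `^ (b0 - beta1) * (2 * 2 `^ (b0 + 1)) * y n `^ (beta1 + 1)).
    by rewrite ler_piMl ?powR_ge0.
  by ring.
Unshelve. all: by end_near. Qed.

(** For large n, a value of rho_n n^(beta1 / (2 beta1 + 1)) below [c] would put rho_n below the
    separation of the perturbed law. That law would then belong to the alternative, against
    [two_point_risk]. *)
Lemma consistent_rate_lower_bound (rho : nat -> R) (Psi : forall n, test n) :
  uniformly_consistent alpha (fun=> pareto_class tau beta0 C C')
    (fun n => separated_class tau beta1 beta0 C C' (rho n)) Psi ->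
  (0 < limn_einf (fun n => (rho n * n%:R `^ (beta1 / (2 * beta1 + 1)))%:E))%E.
Proof.
move=> cons; pose c := C' * theta `^ beta1 / 4.
have c0 : 0 < c by rewrite divr_gt0// mulr_gt0// powR_gt0.
apply: (@lt_le_trans _ _ c%:E); first by rewrite lte_fin.
apply: limn_einf_ge; near=> n.
have n0 : (0 < n)%N by near: n; exact: nbhs_infty_gt.
have n0R : 0 < n%:R :> R by rewrite ltr0n.
have y0 : 0 < y n by rewrite mulr_gt0// powR_gt0.
have risk : (sup_risk (pareto_class tau beta0 C C') (fun X => (Psi n X)%:R)
    + sup_risk (separated_class tau beta1 beta0 C C' (rho n)) (fun X => 1 - (Psi n X)%:R)%R
    <= alpha%:E)%E by near: n; exact: cons.
have adm : [/\ 4 * C * y n <= 1, C' * y n `^ beta1 <= C &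
    forall b0, beta0 = b0%:E -> 2 * (2 * y n) `^ (b0 + 1) <= y n `^ (beta1 + 1)].
  by near: n; exact: admissible.
case: adm => y1 yC yb.
have [P [Q [F [PF0 QF sepF lrt]]]] :=
  pareto_alternative tau_gt0 C_gt0 C'_gt0 beta1_gt0 y0 y1 yC beta10 yb.
rewrite lee_fin leNgt; apply/negP => rho_small.
have rho_le : rho n <= C' * y n `^ beta1 / 4.
  have -> : C' * y n `^ beta1 / 4 = c * n%:R `^ (- nu).
    rewrite /y powRM ?powR_ge0 ?(ltW theta_gt0)// -powRrM mulNr (mulrC _^-1) -/nu /c.
    by ring.
  by rewrite powRN ler_pdivlMr ?powR_gt0// ltW.
have HF0 : pareto_class tau beta0 C C' (exact_pareto tau C).
  case: beta0 beta10 => // b0 _; exact: exact_pareto_class.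
have HF1 : separated_class tau beta1 beta0 C C' (rho n) F.
  by case: sepF => HF sep; split => //; apply: le_trans sep; rewrite lee_fin.
pose A : set (n.-tuple (measurableTypeR R)) := [set X | Psi n X].
have mA : measurable A.
  rewrite -[A]setTI (_ : A = Psi n @^-1` [set true]); last by apply/seteqP; split.
  exact: (measurable_funP (Psi n)).
have E0 : ('E_(iid_law P n)[(fun X => (Psi n X)%:R)%R] = iid_law P n A)%E.
  rewrite -expectation_indic//; congr expectation; apply/funext => X.
  by rewrite indicE; congr (nat_of_bool _)%:R; apply/idP/idP => [/mem_set|/set_mem].
have E1 : ('E_(iid_law Q n)[(fun X => 1 - (Psi n X)%:R)%R] = iid_law Q n (~` A))%E.
  rewrite -expectation_indic; last exact: measurableC.
  congr expectation; apply/funext => X; rewrite indicE in_setC.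
  rewrite (_ : X \in A = Psi n X); first by case: (Psi n X); rewrite ?subrr ?subr0.
  by apply/idP/idP => [/set_mem|/mem_set].
have r0 := sup_risk_ge (fun X => (Psi n X)%:R) HF0 PF0.
have r1 := sup_risk_ge (fun X => 1 - (Psi n X)%:R) HF1 QF.
have := le_trans (leeD r0 r1) risk; rewrite E0 E1 probability_setC//.
rewrite -(fineK (fin_num_measure (iid_law P n) _ mA)).
rewrite -(fineK (fin_num_measure (iid_law Q n) _ mA)) -EFinB -EFinD lee_fin.
have := lrt n A lam mA (ltW lam_gt0); have := likelihood_bound n0.
move: (fine (iid_law P n A)) (fine (iid_law Q n A)) => p q.
move: (_ ^+ n) => L HL Hlrt Hrisk.
exact: (two_point_risk alpha_lt1 HL Hlrt Hrisk).
Unshelve. all: by end_near. Qed.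

End lower_bound.

(** The restriction alpha < 1 in the second part excludes a trivial case: for alpha >= 1 the test
    that never rejects has total risk at most 1, whatever rho is. *)
Theorem theorem3p1 (R : realType) (alpha tau C C' beta1 : R) (beta0 : \bar R)
    (alpha_gt0 : 0 < alpha) (tau_gt0 : 0 < tau) (C_gt0 : 0 < C)
    (C'_gt0 : 0 < C') (beta1_gt0 : 0 < beta1)
    (beta10 : (beta1%:E < beta0)%E) :
  let H0 := fun _ : nat => pareto_class tau beta0 C C' in
  let H1 := fun (rho : nat -> R) (n : nat) =>
    separated_class tau beta1 beta0 C C' (rho n) in
  let rescaled := fun (rho : nat -> R) (n : nat) =>
    (rho n * n%:R `^ (beta1 / (2 * beta1 + 1)))%:E in
  (exists rho : nat -> R,
    [/\ forall n, 0 <= rho n,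
        (limn_esup (rescaled rho) < +oo)%E &
        exists Psi : forall n, test n,
          uniformly_consistent alpha H0 (H1 rho) Psi]) /\
  (alpha < 1 ->
   forall rho : nat -> R, (forall n, 0 <= rho n) ->
    (exists Psi : forall n, test n,
      uniformly_consistent alpha H0 (H1 rho) Psi) ->
    (0 < limn_einf (rescaled rho))%E).
Proof.
split; first exact: consistent_test_exists.
move=> alpha_lt1 rho _ [Psi]; exact: consistent_rate_lower_bound.
Qed.
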